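(* Let $A=\mathcal R_{k,\ell}$ for some $k,\ell\in\mathbf Z_+$ and let $\mathfrak I$ be the ideal of $A$ generated by $\{t_1-1,\dots,t_k-1,u_1,\dots,u_\ell\}$. For all $i\in I$, the assignment $w_{\omega_i}\mapsto w_{\omega_i,A/\mathfrak I}\otimes1$ defines an isomorphism of $(\mathfrak g\otimes A,A)$-bimodules $$W_A(\omega_i)\stackrel{\cong}{\longrightarrow}\big(\mathbf W_A^{\omega_i}A/\mathfrak I\otimes A\big)_{\mathbf h_{k,\ell}}.$$
   Context: $\mathfrak g$ is a finite-dimensional complex simple Lie algebra with Cartan subalgebra $\mathfrak h$, simple roots $\{\alpha_i\}_{i\in I}$, positive roots $\Phi^+$, decomposition $\mathfrak g=\mathfrak n^-\oplus\mathfrak h\oplus\mathfrak n^+$, Chevalley basis $\{x^\pm_\alpha:\alpha\in\Phi^+\}\cup\{h_i=h_{\alpha_i}:i\in I\}$, fundamental weights $\omega_i$, and $P^+=\sum_{i\in I}\mathbf Z_+\omega_i$. For a commutative associative unital $\mathbf C$-algebra $A$, $\mathfrak g\otimes A$ is the Lie algebra with bracket $[x\otimes a,y\otimes b]=[x,y]\otimes ab$, and $\mathfrak g$ is identified with $\mathfrak g\otimes1$. $\mathcal R_{k,\ell}=\mathbf C[t_1^{\pm1},\dots,t_k^{\pm1},u_1,\dots,u_\ell]$. Global Weyl module: for $\lambda\in P^+$, $W_A(\lambda)$ is the left $\mathbf U(\mathfrak g\otimes A)$-module generated by $w_\lambda$ with defining relations $(\mathfrak n^+\otimes A)w_\lambda=0$,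 $hw_\lambda=\lambda(h)w_\lambda$ ($h\in\mathfrak h$), $(x^-_{\alpha_i})^{\lambda(h_{\alpha_i})+1}w_\lambda=0$ ($i\in I$). It is a right $\mathbf U(\mathfrak h\otimes A)$-module via $(uw_\lambda)(h\otimes a)=u(h\otimes a)w_\lambda$; put $\mathbf A_\lambda=\mathbf U(\mathfrak h\otimes A)/\operatorname{Ann}_{\mathbf U(\mathfrak h\otimes A)}w_\lambda$, so that $W_A(\lambda)$ is a $(\mathfrak g\otimes A,\mathbf A_\lambda)$-bimodule. For $A=\mathcal R_{k,\ell}$ it is known that $\mathbf A_{\omega_i}\cong A$, the class of $h_i\otimes a$ corresponding to $a$ (and that of $h_j\otimes a$ to $0$ for $j\ne i$); thus $W_A(\omega_i)$ is a $(\mathfrak g\otimes A,A)$-bimodule with $(uw_{\omega_i})a=u(h_i\otimes a)w_{\omega_i}$. Fundamental local Weyl module: for a maximal ideal $\mathfrak I$ of $A$, $\mathbf W_A^{\omega_i}A/\mathfrak I=W_A(\omega_i)\otimes_AA/\mathfrak I$, and $w_{\omega_i,A/\mathfrak I}=w_{\omega_i}\otimes1$. Comultiplication: $\mathbf h_{k,\ell}:A\to A\otimes A$ is the algebra homomorphism with $\mathbf h_{k,\ell}(t_s^{\pm1})=t_s^{\pm1}\otimes t_s^{\pm1}$ and $\mathbf h_{k,\ell}(u_r)=u_r\otimes1+1\otimes u_r$. For a $\mathfrak g\otimes A$-module $V$ and a comultiplication $\mathbf h$ on $A$, $(V\otimes A)_{\mathbf h}$ denotes $V\otimes A$ with the $(\mathfrak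 g\otimes A,A)$-bimodule structure $(x\otimes a)(v\otimes b)=\sum_s(x\otimes a'_s)v\otimes a''_sb$ and $(v\otimes b)a=v\otimes ba$, where $\mathbf h(a)=\sum_sa'_s\otimes a''_s$. *)

(* Defs.v *)
From HB Require Import structures.
From mathcomp Require Import all_boot all_order all_algebra.
From mathcomp Require Import finmap.
From mathcomp Require Import monalg.
From mathcomp Require Import freeg mpoly.
From mathcomp Require Import boolp classical_sets functions reals complex.

Set Implicit Arguments.
Unset Strict Implicit.
Unset Printing Implicit Defensive.

Import Order.TTheory GRing.Theory Num.Theory.
Local Open Scope ring_scope.
Local Open Scope quotient_scope.

Section Span.
Variables (K : pzRingType) (V : lmodType K) (S : set V).

Inductive span : V -> Prop :=
| span_gen x of S x : span x
| span0 : span 0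
| spanL a x y of span x & span y : span (a *: x + y).

Lemma spanD x y : span x -> span y -> span (x + y).
Proof. by move=> hx hy; rewrite -[x]scale1r; exact: spanL. Qed.

Lemma spanZ a x : span x -> span (a *: x).
Proof. by move=> hx; rewrite -[_ *: _]addr0; exact: spanL hx span0. Qed.

Lemma spanN x : span x -> span (- x).
Proof. by rewrite -scaleN1r; exact: spanZ. Qed.

Definition qrel : rel V := fun x y => `[< span (x - y) >].

Lemma qrel_refl : reflexive qrel.
Proof. by move=> x; apply/asboolP; rewrite subrr; exact: span0. Qed.

Lemma qrel_sym : ssrbool.symmetric qrel.
Proof.
by move=> x y; apply/asboolP/asboolP => /spanN; rewrite opprB.
Qed.

Lemma qrel_trans : transitive qrel.
Proof.
move=> y x z /asboolP hxy /asboolP hyz; apply/asboolP.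
by have := spanD hxy hyz; rewrite addrA subrK.
Qed.

Canonical qrel_equiv := EquivRel qrel qrel_refl qrel_sym qrel_trans.

(* The quotient of V by the submodule generated by S. *)
Definition qmod : Type := {eq_quot qrel}.
HB.instance Definition _ := Choice.on qmod.
HB.instance Definition _ := EqQuotient.on qmod.

Definition qpi (x : V) : qmod := locked (\pi_qmod x).

Lemma qpiP x y : qpi x = qpi y <-> span (x - y).
Proof.
rewrite /qpi -!lock.
by split=> [/eqmodP/asboolP//|h]; apply/eqmodP; apply/asboolP.
Qed.

Lemma qpiK q : qpi (repr q) = q.
Proof. by rewrite /qpi -lock reprK. Qed.

Lemma qpi_repr x : span (repr (qpi x) - x).
Proof. by apply/qpiP; rewrite qpiK. Qed.

Lemma qpi_surj q : exists x, q = qpi x.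
Proof. by exists (repr q); rewrite qpiK. Qed.

(* The operations are sealed: only their values on classes matter. *)
Fact qadd_ex : {f : qmod -> qmod -> qmod |
  forall x y, f (qpi x) (qpi y) = qpi (x + y)}.
Proof.
exists (fun p q => qpi (repr p + repr q)) => x y; apply/qpiP.
by rewrite opprD addrACA; exact: spanD (qpi_repr x) (qpi_repr y).
Qed.

Fact qopp_ex : {f : qmod -> qmod | forall x, f (qpi x) = qpi (- x)}.
Proof.
exists (fun p => qpi (- repr p)) => x; apply/qpiP.
by rewrite -opprD; exact/spanN/qpi_repr.
Qed.

Fact qscale_ex : {f : K -> qmod -> qmod |
  forall a x, f a (qpi x) = qpi (a *: x)}.
Proof.
exists (fun a p => qpi (a *: repr p)) => a x; apply/qpiP.
by rewrite -scalerBr; exact/spanZ/qpi_repr.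
Qed.

Let qadd := sval qadd_ex.
Let qaddE x y : qadd (qpi x) (qpi y) = qpi (x + y).
Proof. exact: (svalP qadd_ex). Qed.
Let qopp := sval qopp_ex.
Let qoppE x : qopp (qpi x) = qpi (- x).
Proof. exact: (svalP qopp_ex). Qed.
Let qscale := sval qscale_ex.
Let qscaleE a x : qscale a (qpi x) = qpi (a *: x).
Proof. exact: (svalP qscale_ex). Qed.

Let qaddA : associative qadd.
Proof.
by move=> p q r; case: (qpi_surj p) (qpi_surj q) (qpi_surj r) =>
  [x ->] [y ->] [z ->]; rewrite !qaddE addrA.
Qed.
Let qaddC : commutative qadd.
Proof.
by move=> p q; case: (qpi_surj p) (qpi_surj q) => [x ->] [y ->];
  rewrite !qaddE addrC.
Qed.
Let qadd0 : left_id (qpi 0) qadd.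
Proof. by move=> p; case: (qpi_surj p) => [x ->]; rewrite qaddE add0r. Qed.
Let qaddN : left_inverse (qpi 0) qopp qadd.
Proof.
by move=> p; case: (qpi_surj p) => [x ->]; rewrite qoppE qaddE addNr.
Qed.
HB.instance Definition _ :=
  GRing.isZmodule.Build qmod qaddA qaddC qadd0 qaddN.

Let qpiD x y : qpi x + qpi y = qpi (x + y).
Proof. exact: qaddE. Qed.

Let qscaleA a b p : qscale a (qscale b p) = qscale (a * b) p.
Proof. by case: (qpi_surj p) => [x ->]; rewrite !qscaleE scalerA. Qed.
Let qscale1 : left_id 1 qscale.
Proof. by move=> p; case: (qpi_surj p) => [x ->]; rewrite qscaleE scale1r. Qed.
Let qscaleDr : right_distributive qscale +%R.
Proof.
move=> a p q; case: (qpi_surj p) (qpi_surj q) => [x ->] [y ->].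
by rewrite qpiD !qscaleE qpiD scalerDr.
Qed.
Let qscaleDl p : {morph qscale^~ p : a b / a + b}.
Proof.
move=> a b; case: (qpi_surj p) => [x ->].
by rewrite !qscaleE qpiD scalerDl.
Qed.
HB.instance Definition _ := GRing.Zmodule_isLmodule.Build K qmod
  qscaleA qscale1 qscaleDr qscaleDl.

Lemma qpi_is_linear : linear qpi.
Proof.
by move=> a x y; rewrite -qpiD -[a *: qpi x]/(qscale a (qpi x)) qscaleE.
Qed.
HB.instance Definition _ :=
  GRing.isLinear.Build K V qmod _ qpi qpi_is_linear.

Lemma qpi0P x : qpi x = 0 <-> span x.
Proof. by rewrite -(raddf0 qpi) qpiP subr0. Qed.

Lemma qpi_gen x : S x -> qpi x = 0.
Proof. by move=> Sx; apply/qpi0P; exact: span_gen. Qed.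

(* Meaningful when f is linear and kills S, see qliftE. *)
Definition qlift (W : Type) (f : V -> W) (q : qmod) : W := f (repr q).

Section Qlift.
Variables (W : lmodType K) (f : V -> W).
Hypotheses (f_lin : linear f) (f_S : forall x, S x -> f x = 0).

Lemma lin_span x : span x -> f x = 0.
Proof.
elim=> {x} [x /f_S//||a x y _ fx _ fy]; last by rewrite f_lin fx fy scaler0 addr0.
by have := f_lin (-1) 0 0; rewrite scaler0 addr0 scaleN1r addNr.
Qed.

Lemma qliftE x : qlift f (qpi x) = f x.
Proof.
have := lin_span (qpi_repr x); rewrite -scaleN1r addrC f_lin scaleN1r => /eqP.
by rewrite addrC subr_eq0 => /eqP.
Qed.

Lemma qlift_is_linear : linear (qlift f).
Proof.
move=> a p q; case: (qpi_surj p) (qpi_surj q) => [x ->] [y ->].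
by rewrite -linearP !qliftE f_lin.
Qed.

End Qlift.
End Span.

Lemma span_sub (K : pzRingType) (V : lmodType K) (S T : set V) :
  (forall x, S x -> span T x) -> forall x, span S x -> span T x.
Proof.
move=> ST x; elim=> {x} [x /ST//||a x y _ hx _ hy]; first exact: span0.
exact: spanL.
Qed.

Lemma span_map (K : pzRingType) (V W : lmodType K) (S : set V) (T : set W)
    (f : V -> W) : linear f -> (forall x, S x -> span T (f x)) ->
  forall x, span S x -> span T (f x).
Proof.
move=> fl fS x; elim=> {x} [x /fS//||a x y _ hx _ hy].
  have -> : f 0 = 0; last exact: span0.
  by have := fl (-1) 0 0; rewrite scaler0 addr0 scaleN1r addNr.
by rewrite fl; exact: spanL.
Qed.

Section Tensor.
Variable K : fieldType.

Section Def.
Variables (V W : lmodType K).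

Definition fpure (v : V) (w : W) : {freeg (V * W)%type / K} := [freeg [:: (1, (v, w))]].

Inductive tens_rel : set {freeg (V * W)%type / K} :=
| tens_relL a v v' w :
    tens_rel (fpure (a *: v + v') w - (a *: fpure v w + fpure v' w))
| tens_relR a v w w' :
    tens_rel (fpure v (a *: w + w') - (a *: fpure v w + fpure v w')).

Definition tens : Type := qmod tens_rel.
HB.instance Definition _ := GRing.Lmodule.on tens.

Definition pure (v : V) (w : W) : tens := qpi tens_rel (fpure v w).

Definition bilin (U : lmodType K) (f : V -> W -> U) : Prop :=
  (forall w, linear (f^~ w)) /\ (forall v, linear (f v)).

Lemma pure_bilin : bilin pure.
Proof.
split=> [w a v v'|v a w w'].
  rewrite /pure -linearP; apply/qpiP/span_gen; exact: tens_relL.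
rewrite /pure -linearP; apply/qpiP/span_gen; exact: tens_relR.
Qed.

Lemma tens_ind (P : tens -> Prop) : (forall v w, P (pure v w)) ->
  (forall s t, P s -> P t -> P (s + t)) -> forall t, P t.
Proof.
move=> Pp PD t; have [x ->] := qpi_surj t.
have P0 : P 0.
  have := Pp 0 0; have := pure_bilin.2 0 (-1) 0 0.
  by rewrite scaler0 addr0 scaleN1r addNr => ->.
elim/freeg_ind_dom0: x => [|c [v w] x _ _ IH].
  by rewrite linear0.
rewrite linearD /=; apply: PD => //.
have -> : [freeg [:: (c, (v, w))]] = c *: fpure v w :> {freeg (V * W)%type / K}.
  by apply/eqP/freeg_eqP => k; rewrite coeffZ !coeffU mul1r.
rewrite linearZ /=; have := pure_bilin.2 v c w 0.
have -> : pure v 0 = 0.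
  have := pure_bilin.2 v (-1) 0 0.
  by rewrite scaler0 addr0 scaleN1r addNr.
by rewrite !addr0 => <-; exact: Pp.
Qed.

(* Meaningful when f is bilinear, see tliftE. *)
Definition tlift (U : lmodType K) (f : V -> W -> U) : tens -> U :=
  qlift (fglift (fun p => f p.1 p.2)).

Section Lift.
Variables (U : lmodType K) (f : V -> W -> U).
Hypothesis f_bilin : bilin f.

Let F := fglift (fun p : V * W => f p.1 p.2).

Let FB y z : F (y - z) = F y - F z.
Proof. exact: lift_is_additive. Qed.

Let F_lin : linear F.
Proof.
have F0 : F 0 = 0 by rewrite -(subrr 0) FB subrr.
have FD y z : F (y + z) = F y + F z.
  by have := FB y (0 - z); rewrite (FB 0 z) F0 !sub0r !opprK.
move=> a x y; rewrite FD; congr (_ + _).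
elim/freeg_ind_dom0: x => [|c p x _ _ IH]; first by rewrite scaler0 F0 scaler0.
rewrite scalerDr !FD IH scalerDr; congr (_ + _).
have -> : a *: [freeg [:: (c, p)]] = [freeg [:: ((a * c), p)]] :> {freeg (V * W)%type / K}.
  by apply/eqP/freeg_eqP => k; rewrite coeffZ !coeffU mulrA.
by rewrite /F !liftU scalerA.
Qed.

Let F_pure v w : F (fpure v w) = f v w.
Proof. by rewrite /F /fpure liftU scale1r. Qed.

Let F_rel x : tens_rel x -> F x = 0.
Proof.
move=> r; case: r =>  [a v v' w|a v w w']; rewrite FB F_lin !F_pure.
  by rewrite f_bilin.1 subrr.
by rewrite f_bilin.2 subrr.
Qed.

Lemma tliftE v w : tlift f (pure v w) = f v w.
Proof. by rewrite /tlift /pure (qliftE F_lin F_rel) F_pure. Qed.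

Lemma tlift_is_linear : linear (tlift f).
Proof. exact: (qlift_is_linear F_lin F_rel). Qed.

End Lift.
End Def.
End Tensor.

Section LinearFacts.
Variables (K : pzRingType) (V W : lmodType K) (f : V -> W).
Hypothesis f_lin : linear f.

Lemma lin0 : f 0 = 0.
Proof. by have := f_lin (-1) 0 0; rewrite scaler0 addr0 scaleN1r addNr. Qed.

Lemma linD x y : f (x + y) = f x + f y.
Proof. by have := f_lin 1 x y; rewrite !scale1r. Qed.

Lemma linZ a x : f (a *: x) = a *: f x.
Proof. by have := f_lin a x 0; rewrite lin0 !addr0. Qed.

Lemma linN x : f (- x) = - f x.
Proof. by rewrite -scaleN1r linZ scaleN1r. Qed.

Lemma linB x y : f (x - y) = f x - f y.
Proof. by rewrite linD linN. Qed.

End LinearFacts.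

Section Tensor2.
Variables (K : fieldType) (V W V' W' U : lmodType K).
Variable f : V -> W -> V' -> W' -> U.

(* Meaningful when f is linear in each argument, see tlift2E. *)
Definition tlift2 (s : tens V W) (t : tens V' W') : U :=
  tlift (fun v w => (tlift (f v w) : tens V' W' -> U)) s t.

Hypotheses (f_bilin1 : forall v' w', bilin (fun v w => f v w v' w'))
           (f_bilin2 : forall v w, bilin (f v w)).

Let tlift_bilin : bilin (fun v w => (tlift (f v w) : tens V' W' -> U)).
Proof.
split=> [w a v v'|v a w w']; apply/funext => t;
  rewrite -[RHS]/(a *: tlift _ t + tlift _ t).
  elim/tens_ind: t => [x y|s t IHs IHt].
    by rewrite !tliftE // (f_bilin1 x y).1.
  rewrite !(linD (tlift_is_linear _)) // IHs IHt scalerDr !addrA.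
  by congr (_ + _); rewrite -!addrA; congr (_ + _); rewrite addrC.
elim/tens_ind: t => [x y|s t IHs IHt].
  by rewrite !tliftE // (f_bilin1 x y).2.
rewrite !(linD (tlift_is_linear _)) // IHs IHt scalerDr !addrA.
by congr (_ + _); rewrite -!addrA; congr (_ + _); rewrite addrC.
Qed.

Lemma tlift2E v w v' w' : tlift2 (pure v w) (pure v' w') = f v w v' w'.
Proof. by rewrite /tlift2 !tliftE. Qed.

Lemma tlift2_linearl t : linear (tlift2^~ t).
Proof. by move=> a s s'; rewrite /tlift2 (tlift_is_linear tlift_bilin). Qed.

Lemma tlift2_linearr s : linear (tlift2 s).
Proof.
move=> a t t'; elim/tens_ind: s => [v w|s s' IHs IHs'].
  by rewrite /tlift2 !(tliftE tlift_bilin) tlift_is_linear.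
rewrite !(linD (tlift2_linearl _)) IHs IHs' scalerDr.
by rewrite addrACA.
Qed.

End Tensor2.

HB.mixin Record isLieAlgebra (K : pzRingType) V of GRing.Lmodule K V := {
  lie : V -> V -> V;
  lie_linearl : forall z, linear (lie^~ z);
  lie_linearr : forall x, linear (lie x);
  liexx : forall x, lie x x = 0;
  jacobi : forall x y z,
    lie x (lie y z) + lie y (lie z x) + lie z (lie x y) = 0
}.

#[short(type="lieAlgType")]
HB.structure Definition LieAlgebra (K : pzRingType) :=
  {V of isLieAlgebra K V & GRing.Lmodule K V}.

#[short(type="finLieAlgType")]
HB.structure Definition FinLieAlgebra (K : fieldType) :=
  {V of isLieAlgebra K V & Vector K V}.

Section LieFacts.
Variables (K : pzRingType) (L : lieAlgType K).
Implicit Types x y z : L.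

Lemma lieC x y : lie x y = - lie y x.
Proof.
apply/eqP; rewrite -addr_eq0; apply/eqP.
have := liexx (x + y).
rewrite (linD (lie_linearl _)) !(linD (lie_linearr _)) !liexx.
by rewrite add0r addr0.
Qed.

Lemma lieA x y z : lie (lie x y) z = lie x (lie y z) - lie y (lie x z).
Proof.
have /eqP := jacobi x y z.
rewrite (lieC z (lie x y)) subr_eq0 => /eqP <-.
by rewrite (lieC z x) (linN (lie_linearr _)).
Qed.

End LieFacts.

(* A representation of L: the same thing as a left U(L)-module. *)
HB.mixin Record isLieModule (K : pzRingType) (L : lieAlgType K) V
    of GRing.Lmodule K V := {
  lact : L -> V -> V;
  lact_linearl : forall v, linear (lact^~ v);
  lact_linearr : forall x, linear (lact x);
  lact_lie : forall x y v,
    lact (lie x y) v = lact x (lact y v) - lact y (lact x v)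
}.

#[short(type="lieModType")]
HB.structure Definition LieModule (K : pzRingType) (L : lieAlgType K) :=
  {V of isLieModule K L V & GRing.Lmodule K V}.

HB.mixin Record isLieBimodule (K : fieldType) (L : lieAlgType K)
    (A : comAlgType K) V of LieModule K L V := {
  ract : V -> A -> V;
  ract_linearl : forall a, linear (ract^~ a);
  ract_linearr : forall v, linear (ract v);
  ract1 : forall v, ract v 1 = v;
  ractM : forall v a b, ract v (a * b) = ract (ract v a) b;
  lact_ract : forall x v a, lact x (ract v a) = ract (lact x v) a
}.

#[short(type="lieBimodType")]
HB.structure Definition LieBimodule (K : fieldType) (L : lieAlgType K)
    (A : comAlgType K) := {V of isLieBimodule K L A V & LieModule K L V}.

Section Homs.
Variables (K : fieldType) (L : lieAlgType K) (A : comAlgType K).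

Definition is_lmod_hom (V W : lieModType L) (f : V -> W) : Prop :=
  linear f /\ forall x v, f (lact x v) = lact x (f v).

Definition is_bimod_iso (V W : lieBimodType L A) (f : V -> W) : Prop :=
  [/\ is_lmod_hom f, forall v a, f (ract v a) = ract (f v) a & bijective f].

End Homs.

Section Current.
Variables (K : fieldType) (g : lieAlgType K) (A : comAlgType K).

Definition current : Type := tens g A.
HB.instance Definition _ := GRing.Lmodule.on current.

Definition cpure (x : g) (a : A) : current := pure x a.

Definition clie : current -> current -> current :=
  tlift2 (fun (x : g) (a : A) (y : g) (b : A) => cpure (lie x y) (a * b)).

Let bl1 (y : g) (b : A) : bilin (fun x a => cpure (lie x y) (a * b)).
Proof.
split=> [a c x x'|x c a a'] /=; rewrite /cpure.
  by rewrite lie_linearl; exact: (pure_bilin g A).1.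
by rewrite mulrDl -scalerAl; exact: (pure_bilin g A).2.
Qed.

Let bl2 (x : g) (a : A) : bilin (fun y b => cpure (lie x y) (a * b)).
Proof.
split=> [b c y y'|y c b b'] /=; rewrite /cpure.
  by rewrite lie_linearr; exact: (pure_bilin g A).1.
by rewrite mulrDr -scalerAr; exact: (pure_bilin g A).2.
Qed.

Lemma clieE x a y b :
  clie (cpure x a) (cpure y b) = cpure (lie x y) (a * b).
Proof. exact: tlift2E. Qed.

Lemma clie_linearl t : linear (clie^~ t).
Proof. exact: tlift2_linearl. Qed.

Lemma clie_linearr s : linear (clie s).
Proof. exact: tlift2_linearr. Qed.

Let clieC s t : clie s t = - clie t s.
Proof.
elim/tens_ind: s => [x a|s s' IHs IHs']; last first.
  by rewrite (linD (clie_linearl _)) (linD (clie_linearr _)) IHs IHs' opprD.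
elim/tens_ind: t => [y b|t t' IHt IHt']; last first.
  by rewrite (linD (clie_linearl _)) (linD (clie_linearr _)) IHt IHt' opprD.
rewrite !clieE lieC mulrC /cpure.
by rewrite (linN ((pure_bilin g A).1 _)).
Qed.

Let cliexx s : clie s s = 0.
Proof.
elim/tens_ind: s => [x a|s t IHs IHt].
  by rewrite clieE liexx /cpure (lin0 ((pure_bilin g A).1 _)).
rewrite (linD (clie_linearl _)) !(linD (clie_linearr _)) IHs IHt.
by rewrite add0r addr0 (clieC t s) subrr.
Qed.

Let cjacobi s t u :
  clie s (clie t u) + clie t (clie u s) + clie u (clie s t) = 0.
Proof.
have lD := linD (clie_linearl _); have rD := linD (clie_linearr _).
have aux (a b c d e f : current) :
    a + c + e = 0 -> b + d + f = 0 -> (a + b) + (c + d) + (e + f) = 0.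
  by move=> h1 h2; rewrite (addrACA a b c d) (addrACA (a + c)) h1 h2 addr0.
elim/tens_ind: s => [x a|s s' IHs IHs']; last first.
  by rewrite !(lD, rD); exact: aux.
elim/tens_ind: t => [y b|t t' IHt IHt']; last first.
  by rewrite !(lD, rD); exact: aux.
elim/tens_ind: u => [z c|u u' IHu IHu']; last first.
  by rewrite !(lD, rD); exact: aux.
rewrite !clieE (mulrA b) (mulrC (b * c)) (mulrCA c) (mulrC c b) /cpure.
by rewrite -!(linD ((pure_bilin g A).1 _)) jacobi (lin0 ((pure_bilin g A).1 _)).
Qed.

HB.instance Definition _ := isLieAlgebra.Build K current
  clie_linearl clie_linearr cliexx cjacobi.

End Current.

Section QuotientAlgebra.
Variables (K : pzRingType) (F : algType K) (S : set F).

Inductive ideal_gen : set F :=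
| Ideal_gen a x b of S x : ideal_gen (a * x * b).

(* The quotient of F by the two-sided ideal generated by S. *)
Definition qalg : Type := qmod ideal_gen.
HB.instance Definition _ := GRing.Lmodule.on qalg.

Definition qapi (x : F) : qalg := qpi ideal_gen x.

Let ideal x := span ideal_gen x.

Lemma idealMl a x : ideal x -> ideal (a * x).
Proof.
apply: (span_map (f := fun x => a * x)) => [c y z|y [b y' c Sy]].
  by rewrite mulrDr scalerAr.
by rewrite !mulrA; apply/span_gen; exact: Ideal_gen.
Qed.

Lemma idealMr a x : ideal x -> ideal (x * a).
Proof.
apply: (span_map (f := fun x => x * a)) => [c y z|y [b y' c Sy]].
  by rewrite mulrDl scalerAl.
by rewrite -!mulrA mulrA; apply/span_gen; exact: Ideal_gen.
Qed.

Fact qmul_ex : {f : qalg -> qalg -> qalg |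
  forall x y, f (qapi x) (qapi y) = qapi (x * y)}.
Proof.
exists (fun p q => qapi (repr p * repr q)) => x y; apply/qpiP.
rewrite -/(ideal _); set x' := repr _; set y' := repr _.
have -> : x' * y' - x * y = (x' - x) * y' + x * (y' - y).
  by rewrite mulrBl mulrBr addrA subrK.
by apply: spanD; [apply: idealMr|apply: idealMl]; exact: qpi_repr.
Qed.

Let qmul := sval qmul_ex.
Let qmulE x y : qmul (qapi x) (qapi y) = qapi (x * y).
Proof. exact: (svalP qmul_ex). Qed.

Let qapi_surj (p : qalg) : exists x, p = qapi x := qpi_surj p.
Let qapiD x y : qapi x + qapi y = qapi (x + y).
Proof. by rewrite /qapi linearD. Qed.

Let qmulA : associative qmul.
Proof.
by move=> p q r; case: (qapi_surj p) (qapi_surj q) (qapi_surj r) =>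
  [x ->] [y ->] [z ->]; rewrite !qmulE mulrA.
Qed.
Let qmul1l : left_id (qapi 1) qmul.
Proof. by move=> p; case: (qapi_surj p) => [x ->]; rewrite qmulE mul1r. Qed.
Let qmul1r : right_id (qapi 1) qmul.
Proof. by move=> p; case: (qapi_surj p) => [x ->]; rewrite qmulE mulr1. Qed.
Let qmulDl : left_distributive qmul +%R.
Proof.
by move=> p q r; case: (qapi_surj p) (qapi_surj q) (qapi_surj r) =>
  [x ->] [y ->] [z ->]; rewrite qapiD !qmulE mulrDl qapiD.
Qed.
Let qmulDr : right_distributive qmul +%R.
Proof.
by move=> p q r; case: (qapi_surj p) (qapi_surj q) (qapi_surj r) =>
  [x ->] [y ->] [z ->]; rewrite qapiD !qmulE mulrDr qapiD.
Qed.
HB.instance Definition _ := GRing.Zmodule_isPzRing.Build qalg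
  qmulA qmul1l qmul1r qmulDl qmulDr.

Lemma qapiM x y : qapi (x * y) = qapi x * qapi y.
Proof. by rewrite -[RHS]/(qmul _ _) qmulE. Qed.

Lemma qapi1 : qapi 1 = 1.
Proof. by []. Qed.

Lemma qapi_is_linear : linear qapi.
Proof. exact: linearP. Qed.
HB.instance Definition _ :=
  GRing.isLinear.Build K F qalg _ qapi qapi_is_linear.
HB.instance Definition _ :=
  GRing.isMonoidMorphism.Build F qalg qapi (conj qapi1 qapiM).

Lemma qalg_scalerAl (a : K) (p q : qalg) : a *: (p * q) = (a *: p) * q.
Proof.
by case: (qapi_surj p) (qapi_surj q) => [x ->] [y ->];
  rewrite -(qapiM x y) -!(linZ qapi_is_linear) -qapiM scalerAl.
Qed.
Lemma qalg_scalerAr (a : K) (p q : qalg) : a *: (p * q) = p * (a *: q).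
Proof.
by case: (qapi_surj p) (qapi_surj q) => [x ->] [y ->];
  rewrite -(qapiM x y) -!(linZ qapi_is_linear) -qapiM scalerAr.
Qed.

Lemma qapi_rel x : S x -> qapi x = 0.
Proof.
by move=> Sx; apply/qpi_gen; rewrite -[x]mulr1 -[x]mul1r; exact: Ideal_gen.
Qed.

Lemma qalg_nontrivial (R : comPzRingType) (e : F -> R) :
  {morph e : x y / x - y} -> {morph e : x y / x * y} -> e 1 != 0 ->
  (forall x, S x -> e x = 0) -> (1 : qalg) != 0.
Proof.
move=> eB eM e1 eS; apply: contraNneq e1 => /qpi0P h; apply/eqP.
have e0 : e 0 = 0 by rewrite -(subrr 0) eB subrr.
have eD x y : e (x + y) = e x + e y.
  by have := eB x (0 - y); rewrite (eB 0 y) e0 !sub0r !opprK.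
elim: h => [_ [a x b /eS ex]||a x y _ ex _ ey]; first by rewrite !eM ex mulr0 mul0r.
  exact: e0.
by rewrite eD ey -[x]mul1r scalerAl eM ex mulr0 addr0.
Qed.

End QuotientAlgebra.

Section FreeAlgebra.
Variables (K : comNzRingType) (X : choiceType).

Local Notation malg := (monalg.malg (monalg.fmonom X) K).

(* The multiplication of malg, locked to keep unification from unfolding it. *)
Definition fmul : malg -> malg -> malg := locked (fun x y => x * y).

Let fmulE x y : fmul x y = x * y.
Proof. by rewrite /fmul -lock. Qed.

Let fmulA : associative fmul.
Proof. by move=> x y z; rewrite !fmulE mulrA. Qed.
Let fmul1l : left_id 1 fmul.
Proof. by move=> x; rewrite fmulE mul1r. Qed.
Let fmul1r : right_id 1 fmul.
Proof. by move=> x; rewrite fmulE mulr1. Qed.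
Let fmulDl : left_distributive fmul +%R.
Proof. by move=> x y z; rewrite !fmulE mulrDl. Qed.
Let fmulDr : right_distributive fmul +%R.
Proof. by move=> x y z; rewrite !fmulE mulrDr. Qed.
Let fmul_scalel (a : K) (x y : malg) : a *: fmul x y = fmul (a *: x) y.
Proof. by rewrite !fmulE scalerAl. Qed.
Let fmul_scaler (a : K) (x y : malg) : a *: fmul x y = fmul x (a *: y).
Proof.
rewrite !fmulE (monalg.malgMEw (fsubset_refl (monalg.msupp x))
  (monalg.msuppZ_le a y)) monalg.malgME.
rewrite scaler_sumr; apply: eq_bigr => k1 _.
rewrite scaler_sumr; apply: eq_bigr => k2 _.
have cZ k (z : malg) : monalg.mcoeff k (a *: z) = a * monalg.mcoeff k z.
  exact: monalg.mcoeffZ.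
rewrite (cZ k2 y); move: (monalg.mcoeff k1 x) (monalg.mcoeff k2 y) => c d.
apply/monalg.malgP => k; rewrite [LHS]cZ.
have cU (z : K) : monalg.mcoeff k (monalg.mkmalgU (monalg.mul k1 k2) z) =
    z *+ (monalg.mul k1 k2 == k) by exact: monalg.mcoeffU.
by rewrite [RHS]cU [X in a * X]cU mulrnAr mulrCA.
Qed.
Let fone_neq0 : (1 : malg) != 0.
Proof. exact: oner_neq0. Qed.

(* The free associative K-algebra on X. *)
Definition freealg : Type := malg.
HB.instance Definition _ := GRing.Lmodule.on freealg.
HB.instance Definition _ := GRing.Zmodule_isNzRing.Build freealg
  fmulA fmul1l fmul1r fmulDl fmulDr fone_neq0.
HB.instance Definition _ :=
  GRing.LSemiModule_isLSemiAlgebra.Build K freealg fmul_scalel.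
HB.instance Definition _ :=
  GRing.LSemiAlgebra_isSemiAlgebra.Build K freealg fmul_scaler.

Definition fgen (x : X) : freealg :=
  locked (monalg.mkmalgU (monalg.fmu x) 1).

Definition fcoef1 (x : freealg) : K := monalg.mcoeff (monalg.one : monalg.fmonom X) x.

Lemma fcoef1B : {morph fcoef1 : x y / x - y}.
Proof. by move=> x y; rewrite /fcoef1 monalg.mcoeffB. Qed.

Lemma fcoef1D : {morph fcoef1 : x y / x + y}.
Proof. by move=> x y; rewrite /fcoef1 monalg.mcoeffD. Qed.

Lemma fcoef1M : {morph fcoef1 : x y / x * y}.
Proof.
move=> x y; rewrite /fcoef1 -[x * y]/(fmul x y) fmulE.
exact: (rmorphM (monalg.mcoeff (monalg.one : monalg.fmonom X))).
Qed.

Lemma fcoef11 : fcoef1 1 = 1.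
Proof. exact: (rmorph1 (monalg.mcoeff (monalg.one : monalg.fmonom X))). Qed.

Lemma fcoef1Z a x : fcoef1 (a *: x) = a * fcoef1 x.
Proof. by rewrite /fcoef1 monalg.mcoeffZ. Qed.

Lemma fcoef1_gen x : fcoef1 (fgen x) = 0.
Proof.
rewrite /fcoef1 /fgen -lock monalg.mcoeffU.
suff /negPf -> : monalg.fmu x != monalg.one by [].
by rewrite monalg.fmP monalg.fmU monalg.fm1.
Qed.

End FreeAlgebra.

Section Enveloping.
Variables (K : comNzRingType) (L : lieAlgType K).
Local Notation F := (freealg K L).
Local Notation X := (@fgen K L).

Inductive uea_rel : set F :=
| uea_lin a x y : uea_rel (X (a *: x + y) - (a *: X x + X y))
| uea_lie x y : uea_rel (X (lie x y) - (X x * X y - X y * X x)).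

(* The universal enveloping algebra of L. *)
Definition uea : Type := qalg uea_rel.
HB.instance Definition _ := GRing.PzRing.on uea.
HB.instance Definition _ := GRing.Lmodule.on uea.

Lemma uea_nontrivial : (1 : uea) != 0.
Proof.
apply: (qalg_nontrivial (e := @fcoef1 K L)).
- exact: fcoef1B.
- exact: fcoef1M.
- by rewrite fcoef11 oner_neq0.
move=> _ [a x y|x y].
  by rewrite !(fcoef1B, fcoef1D, fcoef1Z) !fcoef1_gen mulr0 addr0 subr0.
by rewrite fcoef1B fcoef1_gen fcoef1B 2!fcoef1M !fcoef1_gen mulr0 !subr0.
Qed.
HB.instance Definition _ := GRing.PzSemiRing_isNonZero.Build uea uea_nontrivial.
HB.instance Definition _ := GRing.LSemiModule_isLSemiAlgebra.Build K uea
  (@qalg_scalerAl _ _ _).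
HB.instance Definition _ := GRing.LSemiAlgebra_isSemiAlgebra.Build K uea
  (@qalg_scalerAr _ _ _).

Definition uiota (x : L) : uea := qapi uea_rel (X x).

Lemma uiota_linear : linear uiota.
Proof.
move=> a x y; apply/eqP; rewrite -subr_eq0; apply/eqP.
have <- := qapi_rel (uea_lin a x y).
by rewrite (linB (qapi_is_linear _)) (linD (qapi_is_linear _)) (linZ (qapi_is_linear _)).
Qed.

Lemma uiota_lie x y : uiota (lie x y) = uiota x * uiota y - uiota y * uiota x.
Proof.
apply/eqP; rewrite -subr_eq0; apply/eqP.
have <- := qapi_rel (uea_lie x y); rewrite /uiota.
by rewrite 2!(linB (qapi_is_linear _)) (qapiM _ (X x) (X y)) (qapiM _ (X y)).
Qed.

(* The left uea L-module generated by one element w subject to the relations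
   r w = 0 for r in S. *)
Section CyclicModule.
Variable S : set uea.

Inductive lideal_gen : set uea :=
| Lideal_gen u r of S r : lideal_gen (u * r).

Definition cyclic_mod : Type := qmod lideal_gen.
HB.instance Definition _ := GRing.Lmodule.on cyclic_mod.

Definition cpi (u : uea) : cyclic_mod := qpi lideal_gen u.

Definition cyclic_gen : cyclic_mod := cpi 1.

Definition umul (u : uea) : cyclic_mod -> cyclic_mod :=
  qlift (fun u' => cpi (u * u')).

Lemma lidealM u x : span lideal_gen x -> span lideal_gen (u * x).
Proof.
apply: (span_map (f := fun x => u * x)) => [c y z|y [b y' Sy]].
  by rewrite mulrDr scalerAr.
by rewrite mulrA; apply/span_gen; exact: Lideal_gen.
Qed.

Lemma cpi_lin : linear cpi.
Proof. exact: linearP. Qed.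

Lemma umulE u u' : umul u (cpi u') = cpi (u * u').
Proof.
rewrite /umul (qliftE (f := fun u' => cpi (u * u'))) //.
  by move=> c y z; rewrite mulrDr -scalerAr cpi_lin.
by move=> _ [b y Sy]; rewrite mulrA; apply: qpi_gen; exact: Lideal_gen.
Qed.

Lemma cpi_surj v : exists u, v = cpi u.
Proof. exact: qpi_surj. Qed.

Let uact (x : L) : cyclic_mod -> cyclic_mod := umul (uiota x).

Let uact_linearl v : linear (uact^~ v).
Proof.
move=> a x y; case: (cpi_surj v) => u ->; rewrite /uact !umulE.
by rewrite uiota_linear mulrDl -scalerAl cpi_lin.
Qed.

Let uact_linearr x : linear (uact x).
Proof.
move=> a v w; case: (cpi_surj v) (cpi_surj w) => [u ->] [u' ->].
by rewrite /uact -(cpi_lin a u u') !umulE mulrDr -scalerAr cpi_lin.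
Qed.

Let uact_lie x y v : uact (lie x y) v = uact x (uact y v) - uact y (uact x v).
Proof.
case: (cpi_surj v) => u ->; rewrite /uact !umulE uiota_lie mulrBl.
by rewrite (linB cpi_lin) !mulrA.
Qed.

HB.instance Definition _ := isLieModule.Build K L cyclic_mod
  uact_linearl uact_linearr uact_lie.

Lemma cpi_lact x u : lact x (cpi u : cyclic_mod) = cpi (uiota x * u).
Proof. exact: umulE. Qed.

Lemma cyclic_rel r : S r -> cpi r = 0.
Proof. by move=> Sr; apply: qpi_gen; rewrite -[r]mul1r; exact: Lideal_gen. Qed.

End CyclicModule.
End Enveloping.

Section RootData.
Variables (K : fieldType) (g : finLieAlgType K).

Definition simple_lie : Prop :=
  (exists x y : g, lie x y != 0) /\
  forall J : {vspace g}, (forall x y, y \in J -> lie x y \in J) ->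
    J = 0%VS \/ J = fullv.

Definition subalgebra (H : {vspace g}) : Prop :=
  forall x y, x \in H -> y \in H -> lie x y \in H.

(* [x1, [x2, ... [xm, y]]] = 0 in H for m large enough. *)
Definition nilpotent (H : {vspace g}) : Prop :=
  exists m, forall (s : seq g) (y : g), size s = m ->
    {subset s <= H} -> y \in H -> foldr lie y s = 0.

Definition cartan_subalgebra (H : {vspace g}) : Prop :=
  [/\ subalgebra H, nilpotent H &
      forall x, (forall y, y \in H -> lie x y \in H) -> x \in H].

Section Roots.
Variable H : {vspace g}.

Definition hdual : Type := 'Hom(subvs_of H, K^o).
HB.instance Definition _ := Vector.on hdual.

Definition weval (mu : hdual) (h : subvs_of H) : K := mu h.

Definition in_rootspace (b : hdual) (x : g) : Prop :=
  forall h : subvs_of H, lie (vsval h) x = weval b h *: x.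

Definition is_root (b : hdual) : Prop :=
  b != 0 /\ exists2 x, x != 0 & in_rootspace b x.

Definition nat_comb n (al : 'I_n -> hdual) (b : hdual) : Prop :=
  exists c : 'I_n -> nat, b = \sum_i al i *+ c i.

(* al enumerates the simple roots: a basis of the dual of H such that every
   root is, up to sign, a combination of simple roots with coefficients in
   the natural numbers. *)
Definition simple_roots n (al : 'I_n -> hdual) : Prop :=
  [/\ forall i, is_root (al i),
      basis_of fullv [seq al i | i : 'I_n] &
      forall b, is_root b -> nat_comb al b \/ nat_comb al (- b)].

End Roots.

(* The positive and negative members of a Chevalley basis are merged in one
   family rvec indexed by all roots. The fields are not independent:
   root_opp and lie_cor hold for every Cartan subalgebra of a simple g. *)
Record chevalley (n : nat) := Chevalley {
  cartan : {vspace g};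
  cartanP : cartan_subalgebra cartan;
  sroot : 'I_n -> hdual cartan;
  srootP : simple_roots sroot;
  roots : seq (hdual cartan);
  roots_uniq : uniq roots;
  rootsP : forall b : hdual cartan, (b \in roots) <-> is_root b;
  root_opp : forall b : hdual cartan, is_root b -> is_root (- b);
  cor : 'I_n -> subvs_of cartan;
  rvec : hdual cartan -> g;
  rvecP : forall b : hdual cartan, is_root b -> in_rootspace b (rvec b);
  chevalley_basis : basis_of fullv
    ([seq vsval (cor i) | i : 'I_n] ++ [seq rvec b | b <- roots]);
  lie_cor : forall i j, lie (vsval (cor i)) (vsval (cor j)) = 0;
  lie_opp : forall b : hdual cartan, is_root b ->
    exists2 h, lie (rvec b) (rvec (- b)) = vsval h & weval b h = 2%:R;
  corE : forall i, vsval (cor i) = lie (rvec (sroot i)) (rvec (- sroot i));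
  (* c - b *+ r is the first root of the b-string through c *)
  lie_add : forall (b c : hdual cartan) r,
    is_root b -> is_root c -> is_root (b + c) ->
    (forall j, (j <= r)%N -> is_root (c - b *+ j)) ->
    ~ is_root (c - b *+ r.+1) ->
    lie (rvec b) (rvec c) = r.+1%:R *: rvec (b + c) \/
    lie (rvec b) (rvec c) = - (r.+1%:R *: rvec (b + c))
}.

Arguments sroot {n} _ _.
Arguments roots {n} _.
Arguments cor {n} _ _.
Arguments rvec {n} _ _.

Section ChevalleyTheory.
Variables (n : nat) (D : chevalley n).
Local Notation h := (cartan D).
Implicit Types (i j : 'I_n) (a : hdual h) (t : subvs_of h).

Definition positive_root a : Prop := is_root a /\ nat_comb (sroot D) a.

(* x^+_a and x^-_a for a positive root a *)
Definition xplus a : g := rvec D a.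
Definition xminus a : g := rvec D (- a).

Definition nplus : {vspace g} :=
  <<[seq xplus a | a <- roots D & `[< positive_root a >]]>>%VS.

Definition cors : n.-tuple (subvs_of h) := [tuple cor D i | i < n].

(* The i-th fundamental weight: the i-th coordinate on the basis of coroots. *)
Definition fweight i : hdual h := linfun (coord cors i : subvs_of h -> K^o).

Lemma fweightE i j : weval (fweight i) (cor D j) = (i == j)%:R.
Proof.
have free_cors : free cors.
  have := basis_free (chevalley_basis D); rewrite cat_free => /and3P[fc _ _].
  have /freeP f : free [tuple vsval (cor D i) | i < n] by [].
  apply/freeP => k k0; apply: f.
  have /(congr1 vsval) := k0; rewrite linear_sum linear0 => k1.
  rewrite -[RHS]k1; apply: eq_bigr => l _.
  by rewrite linearZ -!tnth_nth !tnth_mktuple.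
have -> : cor D j = cors`_j by rewrite -tnth_nth tnth_mktuple.
by rewrite /weval /fweight lfunE /= coord_free // eq_sym.
Qed.

Lemma lie_cartan_nplus t x : x \in nplus -> lie (vsval t) x \in nplus.
Proof.
move=> /(@coord_span _ _ _ (in_tuple _)) ->.
rewrite (big_morph _ (linD (lie_linearr _)) (lin0 (lie_linearr _))).
apply: memv_suml => k _; rewrite (linZ (lie_linearr _)); apply: memvZ.
set s := map _ _; have ks : (k < size s)%N by [].
have : (in_tuple s)`_k \in s by exact: mem_nth.
case/mapP => a; rewrite mem_filter => /andP[/asboolP[ra pa] aR] ->.
rewrite /xplus (rvecP ra); apply/memvZ/memv_span/mapP; exists a => //.
by rewrite mem_filter aR andbT; apply/asboolP.
Qed.

Lemma xplus_nplus i : xplus (sroot D i) \in nplus.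
Proof.
have [ri _ _] := srootP D.
apply/memv_span/map_f; rewrite mem_filter; apply/andP; split; last exact/rootsP.
apply/asboolP; split=> //; exists (fun j => (j == i) : nat).
rewrite (bigD1 i) //= eqxx big1 ?addr0 // => j /negPf ->.
by rewrite mulr0n.
Qed.

Lemma lie_cartan t t' : lie (vsval t) (vsval t') = 0.
Proof.
have [sub _ _] := cartanP D.
have [ri bas _] := srootP D.
have := sub _ _ (subvsP t) (subvsP t').
set z := lie _ _ => zh.
have -> : z = vsval (vsproj h z) by rewrite vsprojK.
suff -> : vsproj h z = 0 by rewrite linear0.
have root0 a : is_root a -> weval a (vsproj h z) = 0.
  move=> [_ [x x0 ax]]; have := ax (vsproj h z).
  rewrite vsprojK // /z lieA !ax !(linZ (lie_linearr _)) !ax !scalerA mulrC.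
  rewrite subrr => /esym/eqP; rewrite scaler_eq0 (negPf x0) orbF.
  by move/eqP.
have all0 (a : hdual h) : a (vsproj h z) = 0.
  have := memvf a; rewrite -(span_basis bas).
  move=> /(@coord_span _ _ _ (in_tuple _)) ->.
  rewrite sum_lfunE big1 // => k _; rewrite scale_lfunE.
  set s := [seq sroot D i | i : 'I_n]; have ks : (k < size s)%N by [].
  have : (in_tuple s)`_k \in s by exact: mem_nth.
  by case/mapP => i _ ->; rewrite [X in _ *: X](root0 _ (ri i)) scaler0.
have zf := memvf (vsproj h z).
rewrite (coord_vbasis zf) big1 // => k _.
have := all0 (linfun (coord (vbasis fullv) k : subvs_of h -> K^o)).
by rewrite lfunE /= => ->; rewrite scale0r.
Qed.

Lemma lie_xminus t i : lie (vsval t) (xminus (sroot D i)) =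
  - (weval (sroot D i) t *: xminus (sroot D i)).
Proof.
have [ri _ _] := srootP D.
by rewrite /xminus (rvecP (root_opp (ri i))) /weval opp_lfunE scaleNr.
Qed.

Lemma sroot_cor i : weval (sroot D i) (cor D i) = 2%:R.
Proof.
have [ri _ _] := srootP D; have [t] := lie_opp (ri i).
by rewrite -corE => /val_inj ->.
Qed.

End ChevalleyTheory.
End RootData.

Section WeylModule.
Variables (K : numFieldType) (g : finLieAlgType K) (n : nat).
Variables (D : chevalley g n) (A : comAlgType K).
Local Notation h := (cartan D).
Local Notation L := (current g A).
Implicit Types (i j : 'I_n) (lam : hdual h) (t : subvs_of h) (a b : A).

(* When lam is dominant, the m of weyl_xminus is the natural number lam (h_j). *)
Inductive weyl_rel lam : set (uea L) :=
| weyl_nplus x a of x \in nplus D : weyl_rel lam (uiota (cpure x a))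
| weyl_cartan t :
    weyl_rel lam (uiota (cpure (vsval t) 1) - weval lam t *: 1)
| weyl_xminus j m of weval lam (cor D j) = m%:R :
    weyl_rel lam (uiota (cpure (xminus (sroot D j)) 1) ^+ m.+1).

Definition global_weyl lam : Type := cyclic_mod (weyl_rel lam).
HB.instance Definition _ lam := LieModule.on (global_weyl lam).

Definition weyl_gen lam : global_weyl lam := cyclic_gen (weyl_rel lam).

Section WeylVector.
Variables (V : lieModType L).
Implicit Types (x y : g) (v : V).

Definition pact x a v : V := lact (cpure x a) v.

Definition weyl_vector lam v : Prop :=
  [/\ forall x a, x \in nplus D -> pact x a v = 0,
      forall t, pact (vsval t) 1 v = weval lam t *: v &
      forall j m, weval lam (cor D j) = m%:R ->
        iter m.+1 (pact (xminus (sroot D j)) 1) v = 0].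

Lemma pact_linear x a : linear (pact x a).
Proof. exact: lact_linearr. Qed.

Lemma pact_linearl a v : linear (fun x => pact x a v).
Proof.
move=> c x y; rewrite /pact /cpure ((pure_bilin g A).1 a c x y).
by rewrite [LHS]lact_linearl.
Qed.

Lemma pactC x a y b v : pact x a (pact y b v) =
  pact y b (pact x a v) + pact (lie x y) (a * b) v.
Proof.
have := lact_lie (cpure x a) (cpure y b) v.
rewrite -[X in lact X v]/(clie (cpure x a) (cpure y b)) clieE /pact => ->.
by rewrite addrC subrK.
Qed.

Variables (i : 'I_n) (w : V).
Hypothesis ww : weyl_vector (fweight D i) w.
Local Notation e j := (xplus (sroot D j)).
Local Notation f j := (xminus (sroot D j)).
Local Notation hh j := (vsval (cor D j)).

Let wn x a : x \in nplus D -> pact x a w = 0.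
Proof. by case: ww => h1 _ _ xn; exact: h1. Qed.


Let pact0 x a : pact x a 0 = 0. Proof. exact: (lin0 (pact_linear x a)). Qed.

Let he j : lie (e j) (f j) = hh j. Proof. by rewrite corE. Qed.

Let hf j : lie (hh j) (f j) = (- 2%:R) *: f j.
Proof. by rewrite lie_xminus sroot_cor scaleNr. Qed.

Let pactZ c x a v : pact (c *: x) a v = c *: pact x a v.
Proof. exact: (linZ (pact_linearl a v)). Qed.

Lemma weyl_f_ne j a : j != i ->
  [/\ pact (f j) 1 w = 0, pact (hh j) a w = 0 & pact (f j) a w = 0].
Proof.
move=> ji; have fw : pact (f j) 1 w = 0.
  by case: ww => _ _ /(_ j 0%N) /=; apply; rewrite fweightE eq_sym (negPf ji).
have hw b : pact (hh j) b w = 0.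
  have := pactC (e j) b (f j) 1 w.
  by rewrite fw pact0 wn ?xplus_nplus // pact0 add0r he mulr1.
split=> //; have := pactC (hh j) a (f j) 1 w.
rewrite fw pact0 hw pact0 add0r mulr1 hf pactZ => /esym/eqP.
by rewrite scaler_eq0 oppr_eq0 pnatr_eq0 /= => /eqP.
Qed.

Let ff : pact (f i) 1 (pact (f i) 1 w) = 0.
Proof. by case: ww => _ _ /(_ i 1%N) /=; apply; rewrite fweightE eqxx. Qed.

Let hew a b x : x \in nplus D -> pact x b (pact (hh i) a w) = 0.
Proof.
move=> xn; rewrite pactC wn // pact0 add0r lieC.
by rewrite (linN (pact_linearl _ _)) wn ?oppr0 // lie_cartan_nplus.
Qed.

Let fhw a : pact (f i) 1 (pact (hh i) a w) = pact (f i) a w.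
Proof.
have := pactC (e i) a (f i) 1 (pact (f i) 1 w).
rewrite ff pact0 (pactC (e i)) wn ?xplus_nplus // pact0 add0r he mulr1.
rewrite (pactC (hh i) a (f i)) hf mulr1 pactZ addrA -mulr2n -scaler_nat scaleNr.
move/esym/eqP; rewrite subr_eq0 => /eqP; apply: scalerI.
by rewrite pnatr_eq0.
Qed.

Lemma weyl_hM a b :
  pact (hh i) a (pact (hh i) b w) = pact (hh i) (a * b) w.
Proof.
have := congr1 (pact (e i) a) (fhw b).
rewrite pactC hew ?xplus_nplus // pact0 add0r he mulr1 => ->.
by rewrite pactC wn ?xplus_nplus // pact0 add0r he.
Qed.

Lemma weyl_h1 : pact (hh i) 1 w = w.
Proof. by case: ww => _ -> _; rewrite fweightE eqxx scale1r. Qed.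

Let ffh a : pact (f i) 1 (pact (f i) 1 (pact (hh i) a w)) = 0.
Proof.
have := pactC (hh i) a (f i) 1 (pact (f i) 1 w).
rewrite ff pact0 (pactC (hh i) a) (linD (pact_linear _ _)) hf mulr1 !pactZ.
rewrite (linZ (pact_linear _ _)) fhw.
rewrite (pactC (f i) a) liexx (lin0 (pact_linearl _ _)) addr0.
set z := pact _ _ (pact _ _ _) => /esym/eqP.
rewrite -{1}[z]scale1r -!scalerDl scaler_eq0 => /orP[|/eqP//].
by rewrite -addrA -opprD -natrD subr_eq0 (eqr_nat K 1 4).
Qed.

Lemma weyl_vector_h a : weyl_vector (fweight D i) (pact (hh i) a w).
Proof.
split=> [x b|t|j m]; first exact: hew.
  rewrite pactC lie_cartan (lin0 (pact_linearl _ _)) addr0.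
  by case: ww => _ -> _; rewrite (linZ (pact_linear _ _)).
have [->|ji] := eqVneq j i.
  rewrite fweightE eqxx => /eqP; rewrite (eqr_nat K 1) => /eqP <- /=.
  exact: ffh.
rewrite fweightE eq_sym (negPf ji) => /eqP; rewrite (eqr_nat K 0) => /eqP <- /=.
have [fw hw fw'] := weyl_f_ne a ji.
rewrite pactC fw pact0 add0r mul1r lieC lie_xminus opprK pactZ fw'.
by rewrite scaler0.
Qed.

End WeylVector.

Lemma weyl_gen_vector lam : weyl_vector lam (weyl_gen lam).
Proof.
split=> [x a xn|t|j m lm].
- by rewrite /pact cpi_lact mulr1; apply: cyclic_rel; exact: weyl_nplus.
- rewrite /pact cpi_lact mulr1; apply/eqP; rewrite -subr_eq0; apply/eqP.
  have <- := cyclic_rel (weyl_cartan lam t).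
  by rewrite (linB (cpi_lin _)) (linZ (cpi_lin _)).
have <- := cyclic_rel (weyl_xminus lm).
move: m.+1 => k; elim: k => [//|k IH]; rewrite iterS IH.
by rewrite /pact cpi_lact exprS.
Qed.

Section Fundamental.
Variable i : 'I_n.

Definition fund_weyl : Type := global_weyl (fweight D i).
HB.instance Definition _ := LieModule.on fund_weyl.

Definition fund_gen : fund_weyl := weyl_gen (fweight D i).

Local Notation proj u := (cpi (weyl_rel (fweight D i)) u : fund_weyl).
Local Notation ha a := (uiota (cpure (vsval (cor D i)) a)).

(* (u w) a = u (h_i (x) a) w, see fund_ractE *)
Definition fund_ract (v : fund_weyl) (a : A) : fund_weyl :=
  qlift (fun u => proj (u * ha a)) v.

Lemma fund_rel a r : weyl_rel (fweight D i) r -> proj (r * ha a) = 0.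
Proof.
have hE : proj (ha a) = pact (vsval (cor D i)) a fund_gen.
  by rewrite /pact cpi_lact mulr1.
have [hn ht hx] := weyl_vector_h (weyl_gen_vector (fweight D i)) a.
case=> [x b xn|t|j m lm].
- by rewrite -cpi_lact hE; exact: hn.
- have -> : (uiota (cpure (vsval t) 1) - weval (fweight D i) t *: 1) * ha a =
      uiota (cpure (vsval t) 1) * ha a - weval (fweight D i) t *: ha a.
    by rewrite mulrBl -scalerAl mul1r.
  rewrite (linB (cpi_lin _)) (linZ (cpi_lin _)).
  by rewrite -cpi_lact hE -/(pact _ _ _) ht subrr.
have <- := hx j m lm; rewrite -/fund_gen -hE.
move: m.+1 => k; elim: k => [|k IH]; first by rewrite expr0 mul1r.
by rewrite iterS -IH /pact cpi_lact exprS mulrA.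
Qed.

Lemma fund_ractE u a : fund_ract (proj u) a = proj (u * ha a).
Proof.
rewrite /fund_ract (qliftE (f := fun u => proj (u * ha a))) //.
  by move=> c x y; rewrite mulrDl -scalerAl; exact: cpi_lin.
move=> _ [v r rr]; rewrite -mulrA -umulE fund_rel //.
by have := umulE (weyl_rel (fweight D i)) v 0; rewrite mulr0 (lin0 (cpi_lin _)).
Qed.

Let fund_ract_linearl a : linear (fund_ract^~ a).
Proof.
move=> c x y; case: (cpi_surj x) (cpi_surj y) => [u ->] [v ->].
rewrite -(cpi_lin (weyl_rel (fweight D i)) c u v) !fund_ractE.
by rewrite mulrDl -scalerAl; exact: cpi_lin.
Qed.

Let fund_ract_linearr v : linear (fund_ract v).
Proof.
move=> c a b; case: (cpi_surj v) => u ->; rewrite !fund_ractE.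
rewrite /cpure ((pure_bilin g A).2 _ c a b) [X in _ * X]uiota_linear.
by rewrite mulrDr -scalerAr; exact: cpi_lin.
Qed.

Let proj_gen u : proj u = umul u (fund_gen : cyclic_mod _).
Proof. by rewrite umulE mulr1. Qed.

Let fund_ract1 v : fund_ract v 1 = v.
Proof.
case: (cpi_surj v) => u ->; rewrite fund_ractE -umulE.
have := weyl_h1 (weyl_gen_vector (fweight D i)).
by rewrite /pact cpi_lact mulr1 => ->; rewrite -proj_gen.
Qed.

Let fund_ractM v a b : fund_ract v (a * b) = fund_ract (fund_ract v a) b.
Proof.
case: (cpi_surj v) => u ->; rewrite !fund_ractE -mulrA -!umulE.
have := weyl_hM (weyl_gen_vector (fweight D i)) a b.
rewrite /pact (cpi_lact _ (cpure _ b) 1) cpi_lact (cpi_lact _ (cpure _ (a * b)) 1).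
by rewrite !mulr1 (umulE _ (ha a) (ha b)) => ->.
Qed.

Let fund_lact_ract x (v : fund_weyl) a :
  lact x (fund_ract v a) = fund_ract (lact x v) a.
Proof.
case: (cpi_surj v) => u ->; rewrite fund_ractE.
rewrite -[lact x _]/(umul _ _) umulE -[lact x _]/(umul _ _) umulE.
by rewrite fund_ractE mulrA.
Qed.

HB.instance Definition _ := isLieBimodule.Build K L A fund_weyl
  fund_ract_linearl fund_ract_linearr fund_ract1 fund_ractM fund_lact_ract.

End Fundamental.
End WeylModule.

Section Specialization.
Variables (K : fieldType) (L : lieAlgType K) (A : comAlgType K).
Variables (V : lieBimodType L A) (J : set A).

Inductive balanced_rel : set (tens V (qalg J)) :=
| Balanced v a m :
    balanced_rel (pure (ract v a) m - pure v (qapi J a * m)).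

(* The L-module V (x)_A A/(J), where (J) is the ideal generated by J. *)
Definition specialization : Type := qmod balanced_rel.
HB.instance Definition _ := GRing.Lmodule.on specialization.

Definition spure (v : V) (m : qalg J) : specialization :=
  qpi balanced_rel (pure v m).

Definition slact (x : L) : specialization -> specialization :=
  qlift (fun t : tens V (qalg J) =>
    qpi balanced_rel (tlift (fun v m => pure (lact x v) m) t)).

Let bl x : bilin (fun (v : V) (m : qalg J) => pure (lact x v) m).
Proof.
split=> [m c v v'|v c m m'].
  by rewrite lact_linearr; exact: (pure_bilin _ _).1.
exact: (pure_bilin _ _).2.
Qed.

Lemma spure_bilin : bilin spure.
Proof.
split=> [m c v v'|v c m m']; rewrite /spure.
  by rewrite ((pure_bilin _ _).1 _ c v v') linearP.
by rewrite ((pure_bilin _ _).2 _ c m m') linearP.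
Qed.

Lemma spure_ract v a m : spure (ract v a) m = spure v (qapi J a * m).
Proof. by apply/qpiP/span_gen; exact: Balanced. Qed.

Lemma spec_ind (P : specialization -> Prop) : (forall v m, P (spure v m)) ->
  (forall s t, P s -> P t -> P (s + t)) -> forall t, P t.
Proof.
move=> Pp PD q; have [t ->] := qpi_surj q.
elim/tens_ind: t => [v m|s t Ps Pt]; first exact: Pp.
by rewrite linearD; exact: PD.
Qed.

Let slact_lin x : linear (fun t : tens V (qalg J) =>
    qpi balanced_rel (tlift (fun v m => pure (lact x v) m) t)).
Proof. by move=> c s t; rewrite (tlift_is_linear (bl x)) linearP. Qed.

Let slact_rel x t : balanced_rel t ->
  qpi balanced_rel (tlift (fun v m => pure (lact x v) m) t) = 0.
Proof.
case=> v a m; rewrite (linB (tlift_is_linear (bl x))) !(tliftE (bl x)).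
by rewrite lact_ract; apply: qpi_gen; exact: Balanced.
Qed.

Lemma slactE x v m : slact x (spure v m) = spure (lact x v) m.
Proof.
by rewrite /slact (qliftE (slact_lin x) (@slact_rel x)) (tliftE (bl x)).
Qed.

Let slact_linearr x : linear (slact x).
Proof. exact: (qlift_is_linear (slact_lin x) (@slact_rel x)). Qed.

Let slact_linearl t : linear (slact^~ t).
Proof.
move=> c x y; elim/spec_ind: t => [v m|s t IHs IHt].
  by rewrite !slactE lact_linearl spure_bilin.1.
by rewrite !(linD (slact_linearr _)) IHs IHt scalerDr addrACA.
Qed.

Let slact_lie x y t : slact (lie x y) t = slact x (slact y t) - slact y (slact x t).
Proof.
elim/spec_ind: t => [v m|s t IHs IHt].
  by rewrite !slactE lact_lie (linB (spure_bilin.1 _)).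
by rewrite !(linD (slact_linearr _)) IHs IHt opprD addrACA.
Qed.

HB.instance Definition _ := isLieModule.Build K L specialization
  slact_linearl slact_linearr slact_lie.

End Specialization.

Section TensorSquare.
Variables (K : fieldType) (A : comAlgType K).

Definition tens2 : Type := tens A A.
HB.instance Definition _ := GRing.Lmodule.on tens2.

Definition tpure (a b : A) : tens2 := pure a b.

Lemma tpure_bilin : bilin tpure.
Proof. exact: pure_bilin. Qed.

Definition t2mul : tens2 -> tens2 -> tens2 :=
  tlift2 (fun a b a' b' : A => tpure (a * a') (b * b')).

Let bl1 (a' b' : A) : bilin (fun a b => tpure (a * a') (b * b')).
Proof.
split=> [b c a1 a2|a c b1 b2] /=.
  by rewrite mulrDl -scalerAl; exact: tpure_bilin.1.
by rewrite mulrDl -scalerAl; exact: tpure_bilin.2.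
Qed.

Let bl2 (a b : A) : bilin (fun a' b' => tpure (a * a') (b * b')).
Proof.
split=> [b' c a1 a2|a' c b1 b2] /=.
  by rewrite mulrDr -scalerAr; exact: tpure_bilin.1.
by rewrite mulrDr -scalerAr; exact: tpure_bilin.2.
Qed.

Let t2mulE a b a' b' : t2mul (tpure a b) (tpure a' b') = tpure (a * a') (b * b').
Proof. exact: (tlift2E bl1 bl2). Qed.

Let t2mul_l t : linear (t2mul^~ t).
Proof. exact: (tlift2_linearl bl1 bl2). Qed.

Let t2mul_r t : linear (t2mul t).
Proof. exact: (tlift2_linearr bl1 bl2). Qed.

Let t2mulC : commutative t2mul.
Proof.
move=> s t; elim/tens_ind: s => [a b|s s' IHs IHs']; last first.
  by rewrite (linD (t2mul_l _)) (linD (t2mul_r _)) IHs IHs'.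
elim/tens_ind: t => [a' b'|t t' IHt IHt']; last first.
  by rewrite (linD (t2mul_l _)) (linD (t2mul_r _)) IHt IHt'.
by rewrite !t2mulE (mulrC a) (mulrC b).
Qed.

Let t2mulA : associative t2mul.
Proof.
move=> s t u; elim/tens_ind: s => [a1 b1|s s' IHs IHs']; last first.
  by rewrite !(linD (t2mul_l _)) IHs IHs'.
elim/tens_ind: t => [a2 b2|t t' IHt IHt']; last first.
  by rewrite (linD (t2mul_l _)) !(linD (t2mul_r _)) (linD (t2mul_l _)) IHt IHt'.
elim/tens_ind: u => [a3 b3|u u' IHu IHu']; last first.
  by rewrite !(linD (t2mul_r _)) IHu IHu'.
by rewrite !t2mulE !mulrA.
Qed.

Let t2mul1 : left_id (tpure 1 1) t2mul.
Proof.
move=> t; elim/tens_ind: t => [a b|s t IHs IHt]; first by rewrite t2mulE !mul1r.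
by rewrite (linD (t2mul_r _)) IHs IHt.
Qed.

Let t2mulDl : left_distributive t2mul +%R.
Proof. by move=> s t u; exact: (linD (t2mul_l _)). Qed.

Let t2one_neq0 : tpure 1 1 != 0.
Proof.
have mb : bilin (fun a b : A => a * b).
  split=> [b c a1 a2|a c b1 b2]; first by rewrite mulrDl scalerAl.
  by rewrite mulrDr scalerAr.
apply: contra_neq (oner_neq0 A) => h.
have := tliftE mb 1 1; rewrite mulr1 => <-.
by rewrite -/(tpure 1 1) h (lin0 (tlift_is_linear mb)).
Qed.

HB.instance Definition _ := GRing.Zmodule_isComNzRing.Build tens2
  t2mulA t2mulC t2mul1 t2mulDl t2one_neq0.

Lemma tpureM a b a' b' : tpure a b * tpure a' b' = tpure (a * a') (b * b').
Proof. exact: t2mulE. Qed.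

Let t2_scalerAl (c : K) (s t : tens2) : c *: (s * t) = (c *: s) * t.
Proof. by rewrite -[RHS]/(t2mul _ _) (linZ (t2mul_l _)). Qed.

HB.instance Definition _ :=
  GRing.LSemiModule_isLSemiAlgebra.Build K tens2 t2_scalerAl.
HB.instance Definition _ := GRing.Lalgebra_isComAlgebra.Build K tens2.

End TensorSquare.

Section Twist.
Variables (K : fieldType) (g : lieAlgType K) (A : comAlgType K).
Local Notation L := (current g A).

Definition twisted (h : {lrmorphism A -> tens2 A}) (V : lieModType L) : Type :=
  tens V A.
HB.instance Definition _ h V := GRing.Lmodule.on (twisted h V).

Variables (h : {lrmorphism A -> tens2 A}) (V : lieModType L).
Local Notation twist := (twisted h V).

Definition wpure (v : V) (b : A) : twist := pure v b.

Lemma wpure_bilin : bilin wpure.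
Proof. exact: pure_bilin. Qed.

(* For s = sum a' (x) a'', maps v (x) b to sum (x (x) a') v (x) a'' b. *)
Definition twist_op (x : g) : tens2 A -> twist -> twist :=
  tlift2 (fun a' a'' v b => wpure (lact (cpure x a') v) (a'' * b)).

(* (x (x) a) t is twist_op x (h a) t, see tactE *)
Definition tact (X : L) (t : twist) : twist :=
  tlift (fun (x : g) (a : A) => twist_op x (h a) t) X.

Definition tract (t : twist) (a : A) : twist :=
  tlift (fun (v : V) (b : A) => wpure v (b * a)) t.

Let lactl (v : V) (a : A) : linear (fun x : g => lact (cpure x a) v).
Proof.
move=> c x y; rewrite /cpure ((pure_bilin g A).1 a c x y).
by rewrite [LHS]lact_linearl.
Qed.

Let lactm (x : g) (v : V) : linear (fun a : A => lact (cpure x a) v).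
Proof.
move=> c a b; rewrite /cpure ((pure_bilin g A).2 x c a b).
by rewrite [LHS]lact_linearl.
Qed.

Let bl1 x (v : V) (b : A) :
  bilin (fun a' a'' => wpure (lact (cpure x a') v) (a'' * b)).
Proof.
split=> [a'' c a b'|a' c a b'] /=.
  by rewrite lactm; exact: wpure_bilin.1.
by rewrite mulrDl -scalerAl; exact: wpure_bilin.2.
Qed.

Let bl2 x a' (a'' : A) :
  bilin (fun v b => wpure (lact (cpure x a') v) (a'' * b)).
Proof.
split=> [b c v v'|v c b b'] /=.
  by rewrite lact_linearr; exact: wpure_bilin.1.
by rewrite mulrDr -scalerAr; exact: wpure_bilin.2.
Qed.

Lemma twist_opE x a' a'' v b :
  twist_op x (tpure a' a'') (wpure v b) = wpure (lact (cpure x a') v) (a'' * b).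
Proof. exact: (tlift2E (bl1 x) (bl2 x)). Qed.

Lemma twist_op_linearl x t : linear (fun s => twist_op x s t).
Proof. exact: (tlift2_linearl (bl1 x) (bl2 x)). Qed.

Lemma twist_op_linearr x s : linear (twist_op x s).
Proof. exact: (tlift2_linearr (bl1 x) (bl2 x)). Qed.

Lemma twist_op_linear s t : linear (fun x => twist_op x s t).
Proof.
move=> c x y; elim/tens_ind: s => [a' a''|s s' IHs IHs']; last first.
  by rewrite !(linD (twist_op_linearl _ _)) IHs IHs' scalerDr addrACA.
elim/tens_ind: t => [v b|t t' IHt IHt']; last first.
  by rewrite !(linD (twist_op_linearr _ _)) IHt IHt' scalerDr addrACA.
by rewrite !twist_opE lactl; exact: wpure_bilin.1.
Qed.

Lemma twist_op_lie x y s s' t : twist_op (lie x y) (s * s') t =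
  twist_op x s (twist_op y s' t) - twist_op y s' (twist_op x s t).
Proof.
elim/tens_ind: s => [a a1|s1 s2 IH1 IH2]; last first.
  rewrite mulrDl !(linD (twist_op_linearl _ _)) IH1 IH2.
  by rewrite (linD (twist_op_linearr _ _)) opprD addrACA.
elim/tens_ind: s' => [a' a1'|s1 s2 IH1 IH2]; last first.
  rewrite mulrDr !(linD (twist_op_linearl _ _)) IH1 IH2.
  by rewrite (linD (twist_op_linearr _ _)) opprD addrACA.
elim/tens_ind: t => [v b|t t' IHt IHt']; last first.
  by rewrite !(linD (twist_op_linearr _ _)) IHt IHt' opprD addrACA.
rewrite [_ * _]tpureM !twist_opE -clieE.
rewrite [lact (clie _ _) v](lact_lie (cpure x a) (cpure y a') v).
by rewrite (linB (wpure_bilin.1 _)) -!mulrA (mulrCA a1').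
Qed.

Let tact_bilin t : bilin (fun (x : g) (a : A) => twist_op x (h a) t).
Proof.
split=> [a|x c a b]; first exact: twist_op_linear.
by rewrite linearP twist_op_linearl.
Qed.

Lemma tactE x a t : tact (cpure x a) t = twist_op x (h a) t.
Proof. exact: (tliftE (tact_bilin t)). Qed.

Let tact_linearl t : linear (tact^~ t).
Proof. exact: (tlift_is_linear (tact_bilin t)). Qed.

Let tact_linearr X : linear (tact X).
Proof.
move=> c s t; elim/tens_ind: X => [x a|X Y IHX IHY].
  by rewrite !tactE twist_op_linearr.
by rewrite !(linD (tact_linearl _)) IHX IHY scalerDr addrACA.
Qed.

Let tact_lie X Y t : tact (lie X Y) t = tact X (tact Y t) - tact Y (tact X t).
Proof.
elim/tens_ind: X => [x a|X X' IH IH']; last first.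
  rewrite (linD (lie_linearl _)) !(linD (tact_linearl _)) IH IH'.
  by rewrite (linD (tact_linearr _)) opprD addrACA.
elim/tens_ind: Y => [y b|Y Y' IH IH']; last first.
  rewrite (linD (lie_linearr _)) !(linD (tact_linearl _)) IH IH'.
  by rewrite (linD (tact_linearr _)) opprD addrACA.
rewrite [lie _ _]clieE !tactE rmorphM; exact: twist_op_lie.
Qed.

HB.instance Definition _ := isLieModule.Build K L twist
  tact_linearl tact_linearr tact_lie.

Let tract_bilin a : bilin (fun (v : V) (b : A) => wpure v (b * a)).
Proof.
split=> [b|v c b b']; first exact: wpure_bilin.1.
by rewrite mulrDl -scalerAl; exact: wpure_bilin.2.
Qed.

Lemma tractE v b a : tract (wpure v b) a = wpure v (b * a).
Proof. exact: (tliftE (tract_bilin a)). Qed.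

Let tract_linearl a : linear (tract^~ a).
Proof. exact: (tlift_is_linear (tract_bilin a)). Qed.

Let tract_linearr t : linear (tract t).
Proof.
move=> c a b; elim/tens_ind: t => [v a'|s t IHs IHt].
  by rewrite !tractE mulrDr -scalerAr wpure_bilin.2.
by rewrite !(linD (tract_linearl _)) IHs IHt scalerDr addrACA.
Qed.

Let tract1 t : tract t 1 = t.
Proof.
elim/tens_ind: t => [v b|s t IHs IHt]; first by rewrite tractE mulr1.
by rewrite (linD (tract_linearl _)) IHs IHt.
Qed.

Let tractM t a b : tract t (a * b) = tract (tract t a) b.
Proof.
elim/tens_ind: t => [v c|s t IHs IHt]; first by rewrite !tractE mulrA.
by rewrite !(linD (tract_linearl _)) IHs IHt.
Qed.

Let twist_op_tract x s t a :
  twist_op x s (tract t a) = tract (twist_op x s t) a.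
Proof.
elim/tens_ind: s => [a' a''|s s' IHs IHs']; last first.
  by rewrite !(linD (twist_op_linearl _ _)) (linD (tract_linearl _)) IHs IHs'.
elim/tens_ind: t => [v b|t t' IHt IHt']; last first.
  rewrite (linD (tract_linearl _)) !(linD (twist_op_linearr _ _)) IHt IHt'.
  by rewrite (linD (tract_linearl _)).
by rewrite tractE !twist_opE tractE mulrA.
Qed.

Let tact_tract (X : L) (t : twist) a : lact X (tract t a) = tract (lact X t) a.
Proof.
rewrite -[LHS]/(tact _ _) -[lact X t]/(tact _ _).
elim/tens_ind: X => [x b|X Y IHX IHY].
  by rewrite !tactE twist_op_tract.
by rewrite !(linD (tact_linearl _)) (linD (tract_linearl _)) IHX IHY.
Qed.

HB.instance Definition _ := isLieBimodule.Build K L A twist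
  tract_linearl tract_linearr tract1 tractM tact_tract.

End Twist.

Section Laurent.
Variables (K : fieldType) (k l : nat).
Implicit Types (s : 'I_k) (r : 'I_l).
Local Notation P := (mpoly.mpoly (k + k + l) K).

Definition pvar (v : 'I_k + 'I_k + 'I_l) : P :=
  'X_(unsplit (match v with
               | inl p => inl (unsplit p)
               | inr r => inr r
               end)).

(* K[t_1^{+-1}, ..., t_k^{+-1}, u_1, ..., u_l] as the quotient of a polynomial
   ring in the t_s, the u_r and formal inverses of the t_s. *)
Inductive laurent_rel : set P :=
| Laurent_rel s : laurent_rel (pvar (inl (inl s)) * pvar (inl (inr s)) - 1).

Definition laurent : Type := qalg laurent_rel.
HB.instance Definition _ := GRing.PzRing.on laurent.
HB.instance Definition _ := GRing.Lmodule.on laurent.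

Definition lproj : P -> laurent := qapi laurent_rel.

Section Eval.
Variables (B : comAlgType K) (v : 'I_k + 'I_k + 'I_l -> B).

Definition peval : P -> B :=
  mpoly.mmap (in_alg B) (fun i => match fintype.split i with
                      | inl p => v (inl (fintype.split p))
                      | inr r => v (inr r)
                      end).

Lemma peval_var x : peval (pvar x) = v x.
Proof.
rewrite /peval /pvar mpoly.mmapX mpoly.mmap1U.
by case: x => [p|r]; rewrite unsplitK // unsplitK.
Qed.

Lemma pevalM : {morph peval : p q / p * q}.
Proof. exact: rmorphM. Qed.

Lemma pevalB : {morph peval : p q / p - q}.
Proof. exact: rmorphB. Qed.

Lemma peval1 : peval 1 = 1.
Proof. exact: rmorph1. Qed.

Lemma peval_lin : linear peval.
Proof.
by move=> c p q; rewrite /peval rmorphD /= mpoly.mmapZ /= mulr_algl.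
Qed.

Hypothesis v_inv : forall s, v (inl (inl s)) * v (inl (inr s)) = 1.

Lemma peval_rel p : laurent_rel p -> peval p = 0.
Proof. by case=> s; rewrite pevalB pevalM !peval_var peval1 v_inv subrr. Qed.

Lemma peval_ideal p : ideal_gen laurent_rel p -> peval p = 0.
Proof.
by case=> q x q' /peval_rel xr; rewrite !pevalM xr mulr0 mul0r.
Qed.

Definition leval : laurent -> B := qlift peval.

Lemma levalE p : leval (lproj p) = peval p.
Proof. exact: (qliftE peval_lin peval_ideal). Qed.

End Eval.

Lemma laurent_nontrivial : (1 : laurent) != 0.
Proof.
pose v (x : 'I_k + 'I_k + 'I_l) : K^o := if x is inl _ then 1 else 0.
apply: (qalg_nontrivial (e := peval v)).
- exact: pevalB.
- exact: pevalM.
- by rewrite peval1 oner_neq0.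
by move=> p; apply: peval_rel => s; rewrite mulr1.
Qed.

Lemma lproj_surj x : exists p, x = lproj p.
Proof. exact: qpi_surj. Qed.

Lemma laurent_mulC : commutative (@GRing.mul laurent).
Proof.
move=> x y; case: (lproj_surj x) (lproj_surj y) => [p ->] [q ->].
by rewrite -[LHS]qapiM -[RHS]qapiM mulrC.
Qed.

HB.instance Definition _ :=
  GRing.PzSemiRing_isNonZero.Build laurent laurent_nontrivial.
HB.instance Definition _ :=
  GRing.PzRing_hasCommutativeMul.Build laurent laurent_mulC.
HB.instance Definition _ := GRing.LSemiModule_isLSemiAlgebra.Build K laurent
  (@qalg_scalerAl _ _ _).
HB.instance Definition _ := GRing.Lalgebra_isComAlgebra.Build K laurent.

Definition laurent_t s : laurent := lproj (pvar (inl (inl s))).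
Definition laurent_tinv s : laurent := lproj (pvar (inl (inr s))).
Definition laurent_u r : laurent := lproj (pvar (inr r)).

Lemma laurent_tK s : laurent_t s * laurent_tinv s = 1.
Proof.
apply/eqP; rewrite -subr_eq0; apply/eqP.
have <- := qapi_rel (Laurent_rel s).
rewrite (linB (qapi_is_linear _)); congr (_ - _).
by rewrite [RHS](qapiM laurent_rel (pvar (inl (inl s))) (pvar (inl (inr s)))).
Qed.

(* The generators t_s - 1 and u_r of the ideal of the identity. *)
Inductive laurent_ideal : set laurent :=
| Laurent_ideal_t s : laurent_ideal (laurent_t s - 1)
| Laurent_ideal_u r : laurent_ideal (laurent_u r).

Definition comul_var (x : 'I_k + 'I_k + 'I_l) : tens2 laurent :=
  match x with
  | inl (inl s) => tpure (laurent_t s) (laurent_t s)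
  | inl (inr s) => tpure (laurent_tinv s) (laurent_tinv s)
  | inr r => tpure (laurent_u r) 1 + tpure 1 (laurent_u r)
  end.

Definition comul : laurent -> tens2 laurent := leval comul_var.

Let comul_inv s : comul_var (inl (inl s)) * comul_var (inl (inr s)) = 1.
Proof. by rewrite tpureM laurent_tK. Qed.

Let comulE p : comul (lproj p) = peval comul_var p.
Proof. exact: levalE. Qed.

Lemma comul_is_linear : linear comul.
Proof. exact: (qlift_is_linear (peval_lin _) (peval_ideal comul_inv)). Qed.

Lemma comul_is_monoid_morphism : monoid_morphism comul.
Proof.
split; first by rewrite -[1]/(lproj 1) comulE peval1.
move=> x y; case: (lproj_surj x) (lproj_surj y) => [p ->] [q ->].
by rewrite -[_ * _](qapiM laurent_rel) !comulE pevalM.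
Qed.

HB.instance Definition _ :=
  GRing.isLinear.Build K laurent (tens2 laurent) _ comul comul_is_linear.
HB.instance Definition _ := GRing.isMonoidMorphism.Build
  laurent (tens2 laurent) comul comul_is_monoid_morphism.

Lemma comul_t s : comul (laurent_t s) = tpure (laurent_t s) (laurent_t s).
Proof. by rewrite comulE peval_var. Qed.

Lemma comul_tinv s : comul (laurent_tinv s) = tpure (laurent_tinv s) (laurent_tinv s).
Proof. by rewrite comulE peval_var. Qed.

Lemma comul_u r : comul (laurent_u r) = tpure (laurent_u r) 1 + tpure 1 (laurent_u r).
Proof. by rewrite comulE peval_var. Qed.

End Laurent.

Section LocalWeyl.
Variables (K : numFieldType) (g : finLieAlgType K) (n : nat).
Variables (D : chevalley g n) (A : comAlgType K) (i : 'I_n) (J : set A).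

Definition local_fund_weyl : Type := specialization (fund_weyl D A i) J.
HB.instance Definition _ := LieModule.on local_fund_weyl.

Definition local_fund_gen : local_fund_weyl := spure (fund_gen D A i) 1.

End LocalWeyl.

(* Main.v *)
Require Import Defs.
From HB Require Import structures.
From mathcomp Require Import all_boot all_order all_algebra.
From mathcomp Require Import finmap.
From mathcomp Require Import monalg.
From mathcomp Require Import mpoly.
From mathcomp Require Import classical_sets.
From mathcomp Require Import reals complex.

Set Implicit Arguments.
Unset Strict Implicit.
Unset Printing Implicit Defensive.

Import GRing.Theory.
Local Open Scope ring_scope.

(** The algebra A is a commutative Hopf algebra: it is the coordinate ring of
    the product of k multiplicative and l additive groups, comul is dual to the
    group law, and I is the kernel of the counit eps, which evaluates a function
    at the identity. Write S for the antipode, Delta for comul, W for the global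
    fundamental Weyl module with generator w, and q : W -> W / W I for the
    projection to the local one.

    The vector w (x) 1 satisfies the defining relations of W in the twisted
    module (W (x) A)_Delta, whence a homomorphism delta : v |-> sum v0 (x) v1,
    and W is a Hopf module. The theorem is then the fundamental theorem of Hopf
    modules, W = W / W I (x) A. The map f of the theorem is
    v |-> sum q(v0) (x) v1. To invert it, put psi v = sum v0 S(v1), an element
    of W. Then psi(v a) = eps(a) psi(v) (coinv_ract), so psi factors through q,
    and the inverse of f sends q(v) (x) b to psi(v) b.

    One composite is the identity because it is a homomorphism that fixes w
    (isoK, from iso_inv_hom). The other is the identity as soon as
    f (psi v) = q(v) (x) 1, which follows by induction on v from the case
    v = w, because coinv_lact says how psi changes under x (x) a (iso_coinv).
    Both arguments rest on the fact that a (x) b |-> Delta(a) (1 (x) b) is a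
    bijection of A (x) A, with inverse built from S. This fact, the counit axiom
    and the antipode axiom each compare two algebra homomorphisms out of A, so
    that it suffices to check them on the generators t_s, 1 / t_s and u_r.

    Homomorphisms out of W come from the universal property of modules given by
    a generator and relations over an enveloping algebra (cyclic_lift). *)

(** * Free algebras and modules over enveloping algebras *)

Section FreeAlgebra.
Variables (K : comNzRingType) (X : choiceType).
Local Notation F := (freealg K X).

Definition fword (s : seq X) : F := monalg.mkmalgU (monalg.FMonom s) 1.

Lemma fwordE (p : F) :
  p = \sum_(k <- monalg.msupp p)
        monalg.mcoeff k p *: fword (monalg.fmonom_val k).
Proof.
rewrite [LHS]monalg.monalgE; apply: eq_bigr => k _.
apply/monalg.malgP => m.
rewrite [RHS]monalg.mcoeffZ /fword monalg.fmK [LHS]monalg.mcoeffU.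
rewrite [X in _ * X]monalg.mcoeffU.
by rewrite mulrnAr mulr1.
Qed.

Lemma fword_nil : fword [::] = 1.
Proof. by rewrite /fword -monalg.fmoneE. Qed.

Lemma fword_cons x s : fword (x :: s) = fgen K x * fword s.
Proof.
rewrite /fgen -[RHS]/(fmul _ _) /fmul -!lock /fword.
rewrite [RHS]monalg.fgmulUU mulr1.
rewrite -[X in _ = monalg.mkmalgU X _]/(monalg.fmmul _ _).
by rewrite monalg.fmmulE monalg.fmuE.
Qed.

Lemma freealg_ind (P : F -> Prop) : P 1 ->
  (forall c p q, P p -> P q -> P (c *: p + q)) ->
  (forall x p, P p -> P (fgen K x * p)) -> forall p, P p.
Proof.
move=> P1 PL PX p; have P0 : P 0.
  by have := PL (-1) _ _ P1 P1; rewrite scaleN1r addNr.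
rewrite [p]fwordE; elim/big_rec: _ => [//|k q _ Pq]; apply: PL => //.
elim: (monalg.fmonom_val k) => [|x s IH]; first by rewrite fword_nil.
by rewrite fword_cons; exact: PX.
Qed.

End FreeAlgebra.

Section Evaluation.
Variables (K : fieldType) (L : lieAlgType K) (V : lieModType L).
Local Notation F := (freealg K L).

(** The action of a noncommutative polynomial in elements of L on the vector v:
    a word acts by the successive actions of its letters. *)
Definition feval (v : V) (p : F) : V :=
  \sum_(k <- monalg.msupp p)
    monalg.mcoeff k p *: foldr (@lact K L V) v (monalg.fmonom_val k).

(** A common index set lets polynomials be added term by term. *)
Lemma feval_sub v (p : F) (d : {fset monalg.fmonom L}) :
  (monalg.msupp p `<=` d)%fset -> feval v p =
  \sum_(k <- d)
    monalg.mcoeff k p *: foldr (@lact K L V) v (monalg.fmonom_val k).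
Proof.
move=> le; rewrite [LHS](big_fset_incl _ le) // => k _ /monalg.mcoeff_outdom ->.
by rewrite scale0r.
Qed.

Lemma feval_linear v : linear (feval v).
Proof.
move=> c p q; pose d := (monalg.msupp p `|` monalg.msupp q)%fset.
rewrite (@feval_sub _ p d) ?(@feval_sub _ q d) ?(@feval_sub _ _ d) //.
- rewrite scaler_sumr -big_split; apply: eq_bigr => k _ /=.
  rewrite [monalg.mcoeff k _]monalg.mcoeffD.
  by rewrite [monalg.mcoeff k (_ *: _)]monalg.mcoeffZ scalerDl scalerA.
- apply/fsubsetP => k /(fsubsetP (monalg.msuppD_le _ _)).
  rewrite !inE => /orP[/(fsubsetP (monalg.msuppZ_le _ _)) ->//|->].
  by rewrite orbT.
- exact: fsubsetUr.
- exact: fsubsetUl.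
Qed.

Lemma feval_word v s : feval v (fword K s) = foldr (@lact K L V) v s.
Proof.
rewrite (@feval_sub _ _ [fset monalg.FMonom s]%fset) ?monalg.msuppU_le //.
by rewrite big_seq_fset1 monalg.mcoeffUU scale1r.
Qed.

Lemma feval1 v : feval v 1 = v.
Proof. by rewrite -fword_nil feval_word. Qed.

Lemma feval_gen v x p : feval v (fgen K x * p) = lact x (feval v p).
Proof.
rewrite [p]fwordE mulr_sumr.
rewrite !(big_morph _ (linD (feval_linear v)) (lin0 (feval_linear v))).
rewrite (big_morph _ (linD (lact_linearr x)) (lin0 (lact_linearr x))).
apply: eq_bigr => k _; set c := monalg.mcoeff _ _; set m := monalg.fmonom_val k.
have -> : fgen K x * (c *: fword K m) = c *: fword K (x :: m).
  by rewrite fword_cons scalerAr.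
have fZ s : feval v (c *: fword K s) = c *: foldr (@lact K L V) v s.
  by rewrite [LHS](linZ (feval_linear v)) feval_word.
rewrite [in RHS](fZ m) [LHS](fZ (x :: m)).
exact: esym (linZ (lact_linearr x) c _).
Qed.

Lemma feval_fgen v x : feval v (fgen K x) = lact x v.
Proof. by rewrite -[fgen K x]mulr1 feval_gen feval1. Qed.

Lemma feval0 p : feval 0 p = 0.
Proof.
elim/freealg_ind: p => [|c p q IH IH'|x p IH].
- exact: feval1.
- by rewrite feval_linear IH IH' scaler0 addr0.
by rewrite feval_gen IH (lin0 (lact_linearr x)).
Qed.

Lemma fevalM v p q : feval v (p * q) = feval (feval v q) p.
Proof.
elim/freealg_ind: p => [|c p p' IH IH'|x p IH].
- by rewrite mul1r feval1.
- by rewrite mulrDl -scalerAl !feval_linear IH IH'.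
by rewrite -mulrA !feval_gen IH.
Qed.

Lemma feval_rel v p : ideal_gen (@uea_rel K L) p -> feval v p = 0.
Proof.
case=> a x b xr; rewrite !fevalM; set u := feval v b.
suff -> : feval u x = 0 by exact: feval0.
have B := linB (feval_linear u).
case: xr => [c y z|y z].
  by rewrite B feval_linear !feval_fgen lact_linearl subrr.
rewrite B (B (fgen K y * fgen K z)) (fevalM u (fgen K y)) (fevalM u (fgen K z)).
by rewrite 2!(feval_fgen u) 3!feval_fgen lact_lie subrr.
Qed.

(** The action of U(L) on the fixed vector v; the vector comes first because
    it is the map U(L) -> V, u |-> u v, that is linear and descends to cyclic
    modules. *)
Definition ueval (v : V) : uea L -> V := qlift (feval v).

Lemma uevalE v p : ueval v (qapi (@uea_rel K L) p) = feval v p.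
Proof. exact: (qliftE (feval_linear v) (@feval_rel v)). Qed.

Lemma ueval_linear v : linear (ueval v).
Proof. exact: (qlift_is_linear (feval_linear v) (@feval_rel v)). Qed.

Lemma ueval1 v : ueval v 1 = v.
Proof. by rewrite -[1]/(qapi _ 1) uevalE feval1. Qed.

Lemma uevalM v a b : ueval v (a * b) = ueval (ueval v b) a.
Proof.
have [p ->] := qpi_surj a; have [q ->] := qpi_surj b.
by rewrite -[_ * _](qapiM (@uea_rel K L)) !uevalE fevalM.
Qed.

Lemma ueval_iota v x : ueval v (uiota x) = lact x v.
Proof. by rewrite uevalE feval_fgen. Qed.

Lemma ueval0 a : ueval 0 a = 0.
Proof.
by have [p ->] := qpi_surj a; rewrite uevalE feval0.
Qed.

Section Lift.
Variables (S : set (uea L)) (v : V).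
Hypothesis v_rel : forall r, S r -> ueval v r = 0.

Let v_lideal u : lideal_gen S u -> ueval v u = 0.
Proof. by case=> a r /v_rel r0; rewrite uevalM r0 ueval0. Qed.

(** The universal property of the module with one generator and relations S:
    a vector annihilated by S is the image of the generator. *)
Definition cyclic_lift : cyclic_mod S -> V := qlift (ueval v).

Lemma cyclic_liftE u : cyclic_lift (cpi S u) = ueval v u.
Proof. exact: (qliftE (ueval_linear v) v_lideal). Qed.

Lemma cyclic_lift_gen : cyclic_lift (cyclic_gen S) = v.
Proof. by rewrite cyclic_liftE ueval1. Qed.

Lemma cyclic_lift_hom : is_lmod_hom cyclic_lift.
Proof.
split; first exact: (qlift_is_linear (ueval_linear v) v_lideal).
move=> x y; have [u ->] := cpi_surj y.
by rewrite cpi_lact !cyclic_liftE uevalM ueval_iota.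
Qed.

End Lift.
End Evaluation.

Section CyclicInduction.
Variables (K : fieldType) (L : lieAlgType K) (S : set (uea L)).

Lemma cyclic_ind (P : cyclic_mod S -> Prop) : P (cyclic_gen S) ->
  (forall c v w, P v -> P w -> P (c *: v + w)) ->
  (forall x v, P v -> P (lact x v)) -> forall v, P v.
Proof.
move=> Pg PL PX v; have [u ->] := cpi_surj v; have [p ->] := qpi_surj u.
elim/freealg_ind: p => [//|c p q Pp Pq|x p Pp].
  by rewrite linearP cpi_lin; exact: PL.
by have := PX x _ Pp; rewrite cpi_lact -[_ * _]qapiM.
Qed.

Lemma cyclic_hom_eq (V : lieModType L) (f f' : cyclic_mod S -> V) :
  is_lmod_hom f -> is_lmod_hom f' -> f (cyclic_gen S) = f' (cyclic_gen S) ->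
  f =1 f'.
Proof.
move=> [fL fX] [fL' fX'] ff'; elim/cyclic_ind => [//|c v w IHv IHw|x v IH].
  by rewrite fL fL' IHv IHw.
by rewrite fX fX' IH.
Qed.

End CyclicInduction.

(** * Homomorphisms out of global Weyl modules *)

Section WeylLift.
Variables (K : numFieldType) (g : finLieAlgType K) (n : nat).
Variables (D : chevalley g n) (A : comAlgType K).
Local Notation L := (current g A).
Variables (V : lieModType L) (lam : hdual (cartan D)) (v : V).
Hypothesis v_weyl : weyl_vector lam v.

Lemma weyl_vector_rel r : @weyl_rel K g n D A lam r -> ueval v r = 0.
Proof.
have [vn vt vx] := v_weyl; case=> [x a xn|t|j m lm].
- by rewrite ueval_iota; exact: vn.
- rewrite (linB (ueval_linear v)) (linZ (ueval_linear v)) ueval1 ueval_iota.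
  by apply/eqP; rewrite subr_eq0; apply/eqP; exact: vt.
rewrite -[RHS](vx j m lm); elim: (m.+1) => [|k IH].
  by rewrite expr0 ueval1.
by rewrite exprS uevalM IH ueval_iota.
Qed.

Lemma weyl_lift_ex : exists f : global_weyl A lam -> V,
  is_lmod_hom f /\ f (weyl_gen A lam) = v.
Proof.
exists (cyclic_lift v : cyclic_mod (@weyl_rel K g n D A lam) -> V).
split; first exact: cyclic_lift_hom weyl_vector_rel.
exact: cyclic_lift_gen weyl_vector_rel.
Qed.

End WeylLift.

Section WeylVectors.
Variables (K : numFieldType) (g : finLieAlgType K) (n : nat).
Variables (D : chevalley g n) (A : comAlgType K).
Local Notation L := (current g A).
Variables (V : lieModType L) (lam : hdual (cartan D)) (v : V).
Hypothesis v_weyl : weyl_vector lam v.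

Lemma weyl_vector_hom (W : lieModType L) (f : V -> W) :
  is_lmod_hom f -> weyl_vector lam (f v).
Proof.
move=> [fL fX]; have [vn vt vx] := v_weyl.
split=> [x a xn|t|j m lm]; rewrite /pact.
- by rewrite -fX -/(pact _ _ _) vn // (lin0 fL).
- by rewrite -fX -/(pact _ _ _) vt (linZ fL).
rewrite -(lin0 fL) -(vx j m lm); elim: (m.+1) => [//|k IH].
by rewrite !iterS IH -fX.
Qed.

Lemma pact_twisted1 (h : {lrmorphism A -> tens2 A}) x (u : V) b :
  pact x 1 (wpure h u b) = wpure h (pact x 1 u) b.
Proof.
rewrite /pact -[LHS]/(tact _ _) tactE rmorph1 -[1]/(tpure 1 1).
by rewrite twist_opE mul1r.
Qed.

(** Since h 1 = 1 (x) 1, the constant elements x (x) 1 act on the first factor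
    only, and n^+ (x) A kills v (x) 1 because it kills v. *)
Lemma weyl_vector_twisted (h : {lrmorphism A -> tens2 A}) :
  weyl_vector lam (wpure h v 1).
Proof.
have [vn vt vx] := v_weyl.
have wZ := linZ ((wpure_bilin h V).1 1).
have w0 := lin0 ((wpure_bilin h V).1 1).
split=> [x a xn|t|j m lm].
- rewrite /pact -[LHS]/(tact _ _) tactE.
  elim/tens_ind: (h a) => [a' a''|s t IHs IHt].
    rewrite -/(tpure _ _) twist_opE -/(pact _ _ _) vn //.
    exact: (lin0 ((wpure_bilin h V).1 _)).
  by rewrite (linD (twist_op_linearl _ _)) IHs IHt addr0.
- by rewrite pact_twisted1 vt wZ.
have -> : forall k, iter k (pact (xminus (sroot D j)) 1) (wpure h v 1) =
    wpure h (iter k (pact (xminus (sroot D j)) 1) v) 1.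
  by elim=> [//|k IH]; rewrite iterS IH pact_twisted1.
by rewrite vx.
Qed.

End WeylVectors.

(** * Algebra homomorphisms into and out of A (x) A *)

Section TensorSquareMaps.
Variables (K : fieldType) (A B : comAlgType K).

Definition tleft (a : A) : tens2 A := tpure a 1.
Definition tright (a : A) : tens2 A := tpure 1 a.

Let tleft_lin : linear tleft. Proof. exact: (tpure_bilin A).1. Qed.
Let tright_lin : linear tright. Proof. exact: (tpure_bilin A).2. Qed.
Let tleft_mul : monoid_morphism tleft.
Proof. by split=> // a b; rewrite /tleft tpureM mulr1. Qed.
Let tright_mul : monoid_morphism tright.
Proof. by split=> // a b; rewrite /tright tpureM mulr1. Qed.
HB.instance Definition _ :=
  GRing.isLinear.Build K A (tens2 A) _ tleft tleft_lin.
HB.instance Definition _ :=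
  GRing.isMonoidMorphism.Build A (tens2 A) tleft tleft_mul.
HB.instance Definition _ :=
  GRing.isLinear.Build K A (tens2 A) _ tright tright_lin.
HB.instance Definition _ :=
  GRing.isMonoidMorphism.Build A (tens2 A) tright tright_mul.

Section Augmentation.
Variable eps : {lrmorphism A -> K^o}.

(** The counit followed by the unit K -> A: with values in A rather than K, it
    is a homomorphism of commutative algebras of the kind that t2lift takes. *)
Definition unit_counit (a : A) : A := (eps a : K) *: 1.

Let unit_counit_lin : linear unit_counit.
Proof. by move=> c a b; rewrite /unit_counit linearP scalerDl scalerA. Qed.
Let unit_counit_mul : monoid_morphism unit_counit.
Proof.
split; first by rewrite /unit_counit rmorph1 scale1r.
by move=> a b; rewrite /unit_counit rmorphM -scalerAl mul1r scalerA.
Qed.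
HB.instance Definition _ :=
  GRing.isLinear.Build K A A _ unit_counit unit_counit_lin.
HB.instance Definition _ :=
  GRing.isMonoidMorphism.Build A A unit_counit unit_counit_mul.

End Augmentation.

Variables (f g : {lrmorphism A -> B}).

Definition t2lift : tens2 A -> B := tlift (fun a b => f a * g b).

Let fg_bilin : bilin (fun a b => f a * g b).
Proof.
split=> [b c a a'|a c b b'].
  by rewrite linearP mulrDl -scalerAl.
by rewrite linearP mulrDr -scalerAr.
Qed.

Lemma t2liftE a b : t2lift (tpure a b) = f a * g b.
Proof. exact: (tliftE fg_bilin). Qed.

Lemma t2lift_is_linear : linear t2lift.
Proof. exact: (tlift_is_linear fg_bilin). Qed.

Lemma t2lift_is_monoid_morphism : monoid_morphism t2lift.
Proof.
split; first by rewrite -[1]/(tpure 1 1) t2liftE !rmorph1 mulr1.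
move=> s t; elim/tens_ind: s => [a b|s s' IHs IHs']; last first.
  by rewrite mulrDl !(linD t2lift_is_linear) IHs IHs' mulrDl.
elim/tens_ind: t => [a' b'|t t' IHt IHt']; last first.
  by rewrite mulrDr !(linD t2lift_is_linear) IHt IHt' mulrDr.
by rewrite [_ * _]tpureM !t2liftE !rmorphM mulrACA.
Qed.

HB.instance Definition _ :=
  GRing.isLinear.Build K (tens2 A) B _ t2lift t2lift_is_linear.
HB.instance Definition _ := GRing.isMonoidMorphism.Build (tens2 A) B
  t2lift t2lift_is_monoid_morphism.

End TensorSquareMaps.


Lemma t2lift_leftE (K : fieldType) (A : comAlgType K) (S : {lrmorphism A -> A})
    (a b : A) :
  t2lift (@tleft K A) (@tright K A \o S) (tpure a b) = tpure a (S b).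
Proof. by rewrite [LHS]t2liftE [LHS]tpureM mulr1 mul1r. Qed.

(** * The action of x (x) A (x) A on bimodules *)

Section BimoduleTensorAction.
Variables (K : fieldType) (g : lieAlgType K) (A : comAlgType K).
Local Notation L := (current g A).
Variable V : lieBimodType L A.
Implicit Types (x : g) (a b : A) (v : V) (s : tens2 A).

(** The counterpart of twist_op on a bimodule: x (x) a acts on the left and b on
    the right, for a (x) b in A (x) A. *)
Definition bimod_op x s v : V :=
  tlift (fun a b => ract (lact (cpure x a) v) b) s.

Let op_bilin x v : bilin (fun a b => ract (lact (cpure x a) v) b).
Proof.
split=> [b c a a'|a c b b'].
  rewrite /cpure ((pure_bilin g A).2 x c a a') [lact _ v]lact_linearl.
  exact: ract_linearl.
exact: ract_linearr.
Qed.

Lemma bimod_opE x a b v :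
  bimod_op x (tpure a b) v = ract (lact (cpure x a) v) b.
Proof. exact: (tliftE (op_bilin x v)). Qed.

Lemma bimod_op_linearl x v : linear (fun s => bimod_op x s v).
Proof. exact: (tlift_is_linear (op_bilin x v)). Qed.

Lemma bimod_op_linearr x s : linear (bimod_op x s).
Proof.
move=> c v w; elim/tens_ind: s => [a b|s t IHs IHt].
  by rewrite !bimod_opE lact_linearr ract_linearl.
by rewrite !(linD (bimod_op_linearl _ _)) IHs IHt scalerDr addrACA.
Qed.

Lemma bimod_op_ract x s v b :
  bimod_op x s (ract v b) = bimod_op x (s * tright b) v.
Proof.
elim/tens_ind: s => [a a'|s t IHs IHt].
  by rewrite [_ * _]tpureM !bimod_opE lact_ract mulr1 -ractM mulrC.
by rewrite mulrDl !(linD (bimod_op_linearl _ _)) IHs IHt.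
Qed.

Lemma ract_bimod_op x s v b :
  ract (bimod_op x s v) b = bimod_op x s (ract v b).
Proof.
elim/tens_ind: s => [a a'|s t IHs IHt].
  by rewrite !bimod_opE lact_ract -!ractM mulrC.
by rewrite !(linD (bimod_op_linearl _ _)) (linD (ract_linearl _)) IHs IHt.
Qed.

End BimoduleTensorAction.

Lemma tract_twist_op (K : fieldType) (g : lieAlgType K) (A : comAlgType K)
    (h : {lrmorphism A -> tens2 A}) (V : lieModType (current g A))
    (x : g) (s : tens2 A) (t : twisted h V) (b : A) :
  tract (twist_op x s t) b = twist_op x (s * tright b) t.
Proof.
have tl : {morph (fun u : twisted h V => tract u b) : u u' / u + u'}.
  exact: linD (ract_linearl (s := twisted h V : lieBimodType _ _) b).
elim/tens_ind: s => [a a'|s s' IHs IHs']; last first.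
  by rewrite mulrDl !(linD (twist_op_linearl _ _)) tl IHs IHs'.
elim/tens_ind: t => [v c|t t' IHt IHt']; last first.
  by rewrite !(linD (twist_op_linearr _ _)) tl IHt IHt'.
by rewrite [_ * _]tpureM !twist_opE tractE mulr1 mulrAC.
Qed.

(** * The fundamental theorem of Hopf modules for W *)

Section HopfModule.
Variables (K : numFieldType) (g : finLieAlgType K) (n : nat).
Variables (D : chevalley g n) (A : comAlgType K).
Variables (Delta : {lrmorphism A -> tens2 A}) (eps : {lrmorphism A -> K^o}).
Variables (S : {lrmorphism A -> A}) (J : set A) (i : 'I_n).
Local Notation L := (current g A).

Local Notation S2 := (t2lift (@tleft K A) (@tright K A \o S)).

(* In Sweedler notation S2 (a (x) b) = a (x) S b, and the axioms read:
   sum eps(a') a'' = a, sum a' S(a'') = eps(a),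
   sum a1 (x) a2 S(a3) = a (x) 1 and sum a1 (x) S(a2) a3 = a (x) 1.
   The last two say that a (x) b |-> Delta(a) (1 (x) b) and
   a (x) b |-> S2 (Delta a) (1 (x) b) are inverse to each other. The hypotheses
   on J say that J generates the kernel of eps. *)
Hypothesis counit : forall a, t2lift (unit_counit eps) idfun (Delta a) = a.
Hypothesis antipode : forall a, t2lift idfun S (Delta a) = unit_counit eps a.
Hypothesis galoisK : forall a,
  t2lift Delta (@tright K A) (S2 (Delta a)) = tleft a.
Hypothesis galoisVK : forall a,
  t2lift (S2 \o Delta) (@tright K A) (Delta a) = tleft a.
Hypothesis eps_J : forall a, J a -> eps a = 0.
Hypothesis J_eps : forall a, qapi J a = (eps a : K) *: qapi J 1.

Local Notation W := (fund_weyl D A i).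
Local Notation w := (fund_gen D A i).
Local Notation Wloc := (local_fund_weyl D i J).
Local Notation wloc := (local_fund_gen D i J).
Local Notation T := (twisted Delta Wloc).

Lemma fund_weyl_ind (P : W -> Prop) : P w ->
  (forall c u v, P u -> P v -> P (c *: u + v)) ->
  (forall x a v, P v -> P (lact (cpure x a) v)) -> forall v, P v.
Proof.
move=> Pw PL PX; elim/cyclic_ind => // X v Pv.
elim/tens_ind: X => [x a|X Y PXv PYv]; first exact: PX.
suff -> : lact (X + Y : L) v = 1 *: lact (X : L) v + lact (Y : L) v :> W.
  exact: PL 1 _ _ PXv PYv.
by rewrite scale1r; exact: (linD (lact_linearl (v : W))).
Qed.

Lemma fund_gen_ract a : ract w a = lact (cpure (vsval (cor D i)) a) w.
Proof. by rewrite [LHS]fund_ractE mul1r [RHS]cpi_lact mulr1. Qed.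

Definition to_local (v : W) : Wloc := spure v 1.
Local Notation q := to_local.

Lemma to_local_hom : is_lmod_hom q.
Proof.
split; first exact: (@spure_bilin _ _ _ W J).1.
by move=> x v; rewrite /q -[RHS]/(slact _ _) slactE.
Qed.

Lemma to_local_ract v a : q (ract v a) = (eps a : K) *: q v.
Proof.
by rewrite /q spure_ract mulr1 J_eps (linZ ((@spure_bilin _ _ _ W J).2 v)).
Qed.

(** In the tensor product over A, v (x) a is (v a) (x) 1. *)
Lemma to_local_surj z : exists v, z = q v.
Proof.
elim/spec_ind: z => [v m|_ _ [u ->] [v ->]]; last first.
  by exists (u + v); rewrite (linD to_local_hom.1).
have [a ->] := qpi_surj m; exists (ract v a).
by rewrite /q spure_ract mulr1.
Qed.

Lemma fund_gen_weyl_vector : weyl_vector (fweight D i) w.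
Proof. exact: weyl_gen_vector. Qed.

Lemma local_gen_weyl_vector : weyl_vector (fweight D i) wloc.
Proof.
exact: (weyl_vector_hom fund_gen_weyl_vector to_local_hom).
Qed.

(* delta is the coaction of A on W, and f, the map of the theorem, is delta
   followed by q on the first factor. *)
Section Iso.
Variables (delta : W -> twisted Delta W) (f : W -> T).
Hypotheses (delta_hom : is_lmod_hom delta)
  (delta_w : delta w = wpure Delta w 1).
Hypotheses (f_hom : is_lmod_hom f) (f_w : f w = wpure Delta wloc 1).

Definition untwist : twisted Delta W -> W := tlift (fun v b => ract v (S b)).

Let untwist_bilin : bilin (fun (v : W) b => ract v (S b)).
Proof.
split=> [b|v c b b']; first exact: ract_linearl.
by rewrite linearP; exact: ract_linearr.
Qed.

Lemma untwistE v b : untwist (wpure Delta v b) = ract v (S b).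
Proof. exact: (tliftE untwist_bilin). Qed.

Lemma untwist_linear : linear untwist.
Proof. exact: (tlift_is_linear untwist_bilin). Qed.

Lemma untwist_op x s t :
  untwist (twist_op x s t) = bimod_op x (S2 s) (untwist t).
Proof.
elim/tens_ind: s => [a b|s s' IHs IHs']; last first.
  rewrite (linD (twist_op_linearl _ _)) (linD untwist_linear) IHs IHs'.
  by rewrite (linD (t2lift_is_linear _ _)) (linD (bimod_op_linearl _ _)).
elim/tens_ind: t => [v c|t t' IHt IHt']; last first.
  rewrite (linD (twist_op_linearr _ _)) !(linD untwist_linear) IHt IHt'.
  by rewrite (linD (bimod_op_linearr _ _)).
rewrite -/(tpure _ _) t2lift_leftE twist_opE !untwistE bimod_opE.
by rewrite lact_ract -ractM rmorphM mulrC.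
Qed.

(** The element sum v0 S(v1), where delta v = sum v0 (x) v1; it is coinvariant
    under delta, and coinv is the projection of a Hopf module to its
    coinvariants. *)
Definition coinv (v : W) : W := untwist (delta v).

Lemma coinv_linear : linear coinv.
Proof. by move=> c u v; rewrite /coinv delta_hom.1 untwist_linear. Qed.

Lemma coinv_gen : coinv w = w.
Proof. by rewrite /coinv delta_w untwistE rmorph1 ract1. Qed.

(** coinv is not a homomorphism: since delta is one and S is multiplicative,
    coinv intertwines x (x) a with v |-> sum ((x (x) a') v) S(a''). *)
Lemma coinv_lact x a v :
  coinv (lact (cpure x a) v) = bimod_op x (S2 (Delta a)) (coinv v).
Proof. by rewrite /coinv delta_hom.2 [lact _ (delta v)]tactE untwist_op. Qed.

Lemma bimod_op_cor s :
  bimod_op (vsval (cor D i)) s w = ract w (t2lift idfun idfun s).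
Proof.
elim/tens_ind: s => [a b|s t IHs IHt].
  by rewrite bimod_opE t2liftE -fund_gen_ract ractM.
rewrite (linD (bimod_op_linearl _ _)) IHs IHt (linD (t2lift_is_linear _ _)).
by rewrite (linD (ract_linearr _)).
Qed.

Lemma mul_S2 s : t2lift idfun idfun (S2 s) = t2lift idfun S s.
Proof.
elim/tens_ind: s => [a b|s t IHs IHt]; first by rewrite t2lift_leftE !t2liftE.
by rewrite !(linD (t2lift_is_linear _ _)) IHs IHt.
Qed.

(** Both sides change in the same way under the left action, so only v = w
    matters; there the right action is that of h_i, and coinv (w a) is
    sum w a' S(a''). *)
Lemma coinv_ract v a : coinv (ract v a) = (eps a : K) *: coinv v.
Proof.
elim/fund_weyl_ind: v => [|c u v IHu IHv|x b v IH].
- rewrite fund_gen_ract coinv_lact coinv_gen bimod_op_cor mul_S2 antipode.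
  by rewrite (linZ (ract_linearr _)) ract1.
- by rewrite ract_linearl !coinv_linear IHu IHv scalerDr !scalerA mulrC.
by rewrite -lact_ract !coinv_lact IH (linZ (bimod_op_linearr _ _)).
Qed.

(** As f is a homomorphism for the left action, it suffices to take v = w, where
    the claim is that sum (h_i (x) a') wloc (x) a'' = wloc (x) a. Since
    h_i (x) a' acts on wloc by eps(a'), this is the counit axiom. *)
Lemma iso_ract v a : f (ract v a) = ract (f v) a.
Proof.
elim/fund_weyl_ind: v => [|c u v IHu IHv|x b v IH].
- rewrite fund_gen_ract f_hom.2 f_w [LHS]tactE [RHS]tractE mul1r.
  rewrite -{2}(counit a).
  elim/tens_ind: (Delta a) => [a' a''|s t IHs IHt]; last first.
    rewrite (linD (twist_op_linearl _ _)) IHs IHt (linD (t2lift_is_linear _ _)).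
    by rewrite (linD ((wpure_bilin _ _).2 _)).
  rewrite -/(tpure _ _) twist_opE t2liftE mulr1.
  have -> : lact (cpure (vsval (cor D i)) a') wloc = (eps a' : K) *: wloc.
    by rewrite -to_local_hom.2 -fund_gen_ract to_local_ract.
  rewrite (linZ ((wpure_bilin _ _).1 _)) -(linZ ((wpure_bilin _ _).2 _)).
  by rewrite -scalerAl mul1r.
- by rewrite ract_linearl !f_hom.1 ract_linearl IHu IHv.
by rewrite -lact_ract !f_hom.2 IH lact_ract.
Qed.

Lemma iso_op x s v :
  f (bimod_op x s v) = twist_op x (t2lift Delta (@tright K A) s) (f v).
Proof.
elim/tens_ind: s => [a b|s t IHs IHt]; last first.
  rewrite (linD (bimod_op_linearl _ _)) (linD f_hom.1) IHs IHt.
  by rewrite (linD (t2lift_is_linear _ _)) (linD (twist_op_linearl _ _)).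
rewrite -/(tpure _ _) bimod_opE iso_ract f_hom.2 [lact _ (f v)]tactE.
by rewrite [LHS]tract_twist_op t2liftE.
Qed.

(** By coinv_lact and iso_op, the action of x (x) a on v turns f (coinv v) into
    its image under the operator of x and sum a1 (x) a2 S(a3) = a (x) 1, that
    is, it acts on the first factor only, as it does on q(v) (x) 1. *)
Lemma iso_coinv v : f (coinv v) = wpure Delta (q v) 1.
Proof.
elim/fund_weyl_ind: v => [|c u v IHu IHv|x a v IH].
- by rewrite coinv_gen.
- by rewrite coinv_linear f_hom.1 IHu IHv to_local_hom.1 (wpure_bilin _ _).1.
by rewrite coinv_lact iso_op galoisK IH twist_opE mulr1 to_local_hom.2.
Qed.

Definition eps_bar : qalg J -> K^o := qlift eps.

Let eps_lin : linear eps. Proof. exact: linearP. Qed.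
Let eps_ideal a : ideal_gen J a -> eps a = 0.
Proof.
by case=> b x c /eps_J Jx; rewrite !rmorphM [X in _ * X * _]Jx mulr0 mul0r.
Qed.

Lemma eps_barE a : eps_bar (qapi J a) = eps a.
Proof. exact: (qliftE eps_lin eps_ideal). Qed.

Lemma eps_bar_linear : linear eps_bar.
Proof. exact: (qlift_is_linear eps_lin eps_ideal). Qed.

(** The map induced by coinv on the quotient Wloc of W. *)
Definition local_coinv : Wloc -> W :=
  qlift (tlift (fun v m => (eps_bar m : K) *: coinv v)).

Let lc_bilin : bilin (fun (v : W) m => (eps_bar m : K) *: coinv v).
Proof.
split=> [m c u v|v c m m'].
  by rewrite coinv_linear scalerDr !scalerA mulrC.
by rewrite eps_bar_linear scalerDl scalerA.
Qed.

Let lc_linear := tlift_is_linear lc_bilin.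

Let lc_balanced t : balanced_rel t ->
  tlift (fun (v : W) m => (eps_bar m : K) *: coinv v) t = 0.
Proof.
case=> v a m; have [b ->] := qpi_surj m; rewrite -/(qapi J b) -qapiM.
rewrite (linB lc_linear) !(tliftE lc_bilin) coinv_ract !eps_barE rmorphM.
by rewrite scalerA mulrC subrr.
Qed.

Lemma local_coinvE v : local_coinv (q v) = coinv v.
Proof.
rewrite [LHS](qliftE lc_linear lc_balanced) (tliftE lc_bilin).
by rewrite -[1]/(qapi J 1) eps_barE rmorph1 scale1r.
Qed.

Lemma local_coinv_linear : linear local_coinv.
Proof. exact: (qlift_is_linear lc_linear lc_balanced). Qed.

Definition iso_inv : T -> W := tlift (fun z b => ract (local_coinv z) b).

Let inv_bilin : bilin (fun z b => ract (local_coinv z) b).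
Proof.
split=> [b c z z'|z]; last exact: ract_linearr.
by rewrite local_coinv_linear ract_linearl.
Qed.

Lemma iso_invE v b : iso_inv (wpure Delta (q v) b) = ract (coinv v) b.
Proof. by rewrite [LHS](tliftE inv_bilin) local_coinvE. Qed.

Lemma iso_inv_linear : linear iso_inv.
Proof. exact: (tlift_is_linear inv_bilin). Qed.

Lemma twisted_local_ind (P : T -> Prop) :
  (forall v b, P (wpure Delta (q v) b)) ->
  (forall s t, P s -> P t -> P (s + t)) -> forall t, P t.
Proof.
move=> Pq PD; elim/tens_ind => // z b.
by have [v ->] := to_local_surj z; exact: Pq.
Qed.

Lemma iso_inv_op x s v b : iso_inv (twist_op x s (wpure Delta (q v) b)) =
  bimod_op x (t2lift (S2 \o Delta) (@tright K A) s) (ract (coinv v) b).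
Proof.
elim/tens_ind: s => [a' a''|s t IHs IHt]; last first.
  rewrite (linD (twist_op_linearl _ _)) (linD iso_inv_linear) IHs IHt.
  by rewrite (linD (t2lift_is_linear _ _)) (linD (bimod_op_linearl _ _)).
rewrite -/(tpure _ _) twist_opE t2liftE -to_local_hom.2 iso_invE coinv_lact.
by rewrite -bimod_op_ract ract_bimod_op mulrC ractM.
Qed.

(** The action of x (x) a on the twist becomes on W the operator of x and
    sum a1 (x) S(a2) a3 = a (x) 1. *)
Lemma iso_inv_hom : is_lmod_hom iso_inv.
Proof.
split=> [|X t]; first exact: iso_inv_linear.
elim/twisted_local_ind: t => [v b|s t IHs IHt]; last first.
  by rewrite (linD (lact_linearr X)) !(linD iso_inv_linear) IHs IHt
    (linD (lact_linearr X)).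
elim/tens_ind: X => [x a|X Y IHX IHY].
  rewrite -/(cpure x a) [lact _ (wpure _ _ _)]tactE iso_inv_op galoisVK.
  by rewrite bimod_opE ract1 iso_invE.
rewrite (linD (lact_linearl _)) (linD iso_inv_linear) IHX IHY.
exact: esym (linD (lact_linearl (iso_inv _)) X Y).
Qed.

Lemma isoK : cancel f iso_inv.
Proof.
apply: (@cyclic_hom_eq _ _ _ W (iso_inv \o f) idfun).
- split=> [c u v|x v] /=; first by rewrite f_hom.1 iso_inv_linear.
  by rewrite f_hom.2 iso_inv_hom.2.
- by [].
by rewrite /= -/w f_w -[wloc]/(q w) iso_invE ract1 coinv_gen.
Qed.

Lemma iso_invK : cancel iso_inv f.
Proof.
move=> t; elim/twisted_local_ind: t => [v b|s t IHs IHt].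
  by rewrite iso_invE iso_ract iso_coinv [LHS]tractE mul1r.
by rewrite (linD iso_inv_linear) (linD f_hom.1) IHs IHt.
Qed.

Lemma iso_bimod : is_bimod_iso f.
Proof.
by split=> //; [exact: iso_ract|exists iso_inv; [exact: isoK|exact: iso_invK]].
Qed.

End Iso.

Theorem fund_weyl_iso : exists f : W -> T,
  [/\ is_bimod_iso f, f w = wpure Delta wloc 1 &
    forall f' : W -> T, is_lmod_hom f' -> f' w = wpure Delta wloc 1 -> f' =1 f].
Proof.
have [d [dh dw]] := weyl_lift_ex
  (weyl_vector_twisted fund_gen_weyl_vector Delta).
have [f [fh fw]] := weyl_lift_ex
  (weyl_vector_twisted local_gen_weyl_vector Delta).
exists f; split=> //; first exact: (iso_bimod dh dw fh fw).
by move=> f' f'h f'w; apply: cyclic_hom_eq => //; rewrite [LHS]f'w -fw.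
Qed.

End HopfModule.

(** * The Hopf algebra of Laurent and ordinary polynomials *)

Section LaurentHom.
Variables (K : fieldType) (k l : nat).
Local Notation A := (laurent K k l).
Local Notation P := (mpoly.mpoly (k + k + l) K).
Local Notation pi := (@lproj K k l).

Lemma lproj_linear : linear pi.
Proof. exact: qapi_is_linear. Qed.

Lemma lprojM p q : pi (p * q) = pi p * pi q.
Proof. exact: qapiM. Qed.

Lemma lproj1 : pi 1 = 1.
Proof. by []. Qed.

Lemma laurent_ind (Q : A -> Prop) :
  Q 1 -> (forall s, Q (laurent_t K l s)) ->
  (forall s, Q (laurent_tinv K l s)) -> (forall r, Q (laurent_u K k r)) ->
  (forall c x y, Q x -> Q y -> Q (c *: x + y)) ->
  (forall x y, Q x -> Q y -> Q (x * y)) -> forall x, Q x.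
Proof.
move=> Q1 Qt Qtinv Qu QL QM x; have [p ->] := lproj_surj x.
have Q0 : Q 0 by have := QL (-1) _ _ Q1 Q1; rewrite scaleN1r addNr.
have QX (j : 'I_(k + k + l)) : Q (pi 'X_j).
  have <- : pvar K (match fintype.split j with
      inl p => inl (fintype.split p) | inr r => inr r end) = 'X_j.
    rewrite /pvar; congr 'X_ _; rewrite -[RHS]splitK.
    by case: (fintype.split j) => // q; rewrite splitK.
  by case: (fintype.split j) => [q|r]; [case: (fintype.split q) => s|];
    [exact: Qt|exact: Qtinv|exact: Qu].
elim/mpolyind: p => [|c m p _ _ IH]; first by rewrite (lin0 lproj_linear).
rewrite lproj_linear; apply: (QL _ _ _ _ IH); rewrite mpolyXE_id.
elim/big_rec: _ => [|j q _ Qq]; first by rewrite lproj1.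
rewrite lprojM; apply: (QM _ _ _ Qq).
by elim: (m j) => [|e IHe]; rewrite ?expr0 ?lproj1 // exprS lprojM; exact: QM.
Qed.

Lemma laurent_hom_eq (B : comAlgType K) (f f' : {lrmorphism A -> B}) :
  (forall s, f (laurent_t K l s) = f' (laurent_t K l s)) ->
  (forall s, f (laurent_tinv K l s) = f' (laurent_tinv K l s)) ->
  (forall r, f (laurent_u K k r) = f' (laurent_u K k r)) -> f =1 f'.
Proof.
move=> ft ftinv fu; elim/laurent_ind => // [|c x y IHx IHy|x y IHx IHy].
- by rewrite (rmorph1 f) (rmorph1 f').
- have fL (h : {lrmorphism A -> B}) : linear h by exact: linearP.
  by rewrite !fL IHx IHy.
have fM (h : {lrmorphism A -> B}) : {morph h : a b / a * b} by exact: rmorphM.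
by rewrite !fM IHx IHy.
Qed.

Section Existence.
Variables (B : comAlgType K) (v : 'I_k + 'I_k + 'I_l -> B).
Hypothesis v_inv : forall s, v (inl (inl s)) * v (inl (inr s)) = 1.

Lemma leval_is_linear : linear (leval v).
Proof. exact: (qlift_is_linear (peval_lin v) (peval_ideal v_inv)). Qed.

Lemma leval_is_monoid_morphism : monoid_morphism (leval v).
Proof.
split; first by rewrite -lproj1 levalE // peval1.
move=> x y; case: (lproj_surj x) (lproj_surj y) => [p ->] [q ->].
by rewrite -lprojM !levalE // pevalM.
Qed.

Lemma leval_var x : leval v (pi (pvar K x)) = v x.
Proof. by rewrite levalE // peval_var. Qed.

End Existence.

Definition laurent_counit_var (x : 'I_k + 'I_k + 'I_l) : K^o :=
  if x is inl _ then 1 else 0.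

Definition laurent_antipode_var (x : 'I_k + 'I_k + 'I_l) : A :=
  match x with
  | inl (inl s) => laurent_tinv K l s
  | inl (inr s) => laurent_t K l s
  | inr r => - laurent_u K k r
  end.

Definition laurent_counit : A -> K^o := leval laurent_counit_var.
Definition laurent_antipode : A -> A := leval laurent_antipode_var.

Let counit_inv s :
  laurent_counit_var (inl (inl s)) * laurent_counit_var (inl (inr s)) = 1.
Proof. by rewrite mulr1. Qed.

Let antipode_inv s :
  laurent_antipode_var (inl (inl s)) * laurent_antipode_var (inl (inr s)) = 1.
Proof. by rewrite mulrC laurent_tK. Qed.

HB.instance Definition _ := GRing.isLinear.Build K A K^o _ laurent_counit
  (leval_is_linear counit_inv).
HB.instance Definition _ := GRing.isMonoidMorphism.Build A K^o laurent_counit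
  (leval_is_monoid_morphism counit_inv).
HB.instance Definition _ := GRing.isLinear.Build K A A _ laurent_antipode
  (leval_is_linear antipode_inv).
HB.instance Definition _ := GRing.isMonoidMorphism.Build A A laurent_antipode
  (leval_is_monoid_morphism antipode_inv).

Local Notation Delta := (@comul K k l).
Local Notation eps := laurent_counit.
Local Notation S := laurent_antipode.
Local Notation S2 := (t2lift (@tleft K A) (@tright K A \o S)).

Let epsE := leval_var counit_inv.
Let SE := leval_var antipode_inv.

Lemma counit_t s : eps (laurent_t K l s) = 1.
Proof. exact: epsE. Qed.
Lemma counit_tinv s : eps (laurent_tinv K l s) = 1.
Proof. exact: epsE. Qed.
Lemma counit_u r : eps (laurent_u K k r) = 0.
Proof. exact: epsE. Qed.
Lemma antipode_t s : S (laurent_t K l s) = laurent_tinv K l s.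
Proof. exact: SE. Qed.
Lemma antipode_tinv s : S (laurent_tinv K l s) = laurent_t K l s.
Proof. exact: SE. Qed.
Lemma antipode_u r : S (laurent_u K k r) = - laurent_u K k r.
Proof. exact: SE. Qed.

Lemma unit_counit_t s : unit_counit eps (laurent_t K l s) = 1.
Proof. by rewrite /unit_counit [X in X *: _](counit_t s) scale1r. Qed.
Lemma unit_counit_tinv s : unit_counit eps (laurent_tinv K l s) = 1.
Proof. by rewrite /unit_counit [X in X *: _](counit_tinv s) scale1r. Qed.
Lemma unit_counit_u r : unit_counit eps (laurent_u K k r) = 0.
Proof. by rewrite /unit_counit [X in X *: _](counit_u r) scale0r. Qed.

Lemma laurent_tVK s : laurent_tinv K l s * laurent_t K l s = 1 :> A.
Proof. by rewrite mulrC laurent_tK. Qed.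

Section LiftComul.
Variables (B : comAlgType K) (f f' : {lrmorphism A -> B}).

Lemma t2lift_comul_t s : t2lift f f' (Delta (laurent_t K l s)) =
  f (laurent_t K l s) * f' (laurent_t K l s).
Proof. by rewrite comul_t t2liftE. Qed.

Lemma t2lift_comul_tinv s : t2lift f f' (Delta (laurent_tinv K l s)) =
  f (laurent_tinv K l s) * f' (laurent_tinv K l s).
Proof. by rewrite comul_tinv t2liftE. Qed.

Lemma t2lift_comul_u r : t2lift f f' (Delta (laurent_u K k r)) =
  f (laurent_u K k r) + f' (laurent_u K k r).
Proof.
rewrite comul_u (linD (t2lift_is_linear f f')) !t2liftE.
by rewrite (rmorph1 f) (rmorph1 f') mulr1 mul1r.
Qed.

End LiftComul.

Lemma laurent_counitl a : t2lift (unit_counit eps) idfun (Delta a) = a.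
Proof.
apply: (laurent_hom_eq (f := t2lift (unit_counit eps) idfun \o Delta)
  (f' := idfun)) => [s|s|r] /=.
- by rewrite t2lift_comul_t [X in X * _]unit_counit_t mul1r.
- by rewrite t2lift_comul_tinv [X in X * _]unit_counit_tinv mul1r.
by rewrite t2lift_comul_u [X in X + _]unit_counit_u add0r.
Qed.

Lemma laurent_antipoder a :
  t2lift idfun S (Delta a) = unit_counit eps a.
Proof.
apply: (laurent_hom_eq (f := t2lift idfun S \o Delta)
  (f' := unit_counit eps)) => [s|s|r] /=.
- rewrite t2lift_comul_t [X in _ * X]antipode_t [RHS]unit_counit_t.
  exact: laurent_tK.
- rewrite t2lift_comul_tinv [X in _ * X]antipode_tinv [RHS]unit_counit_tinv.
  exact: laurent_tVK.
rewrite t2lift_comul_u [X in _ + X]antipode_u [RHS]unit_counit_u.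
exact: subrr.
Qed.

Lemma antipode_comul_t s :
  S2 (Delta (laurent_t K l s)) = tpure (laurent_t K l s) (laurent_tinv K l s).
Proof. by rewrite comul_t t2lift_leftE [X in tpure _ X]antipode_t. Qed.
Lemma antipode_comul_tinv s :
  S2 (Delta (laurent_tinv K l s)) =
  tpure (laurent_tinv K l s) (laurent_t K l s).
Proof. by rewrite comul_tinv t2lift_leftE [X in tpure _ X]antipode_tinv. Qed.
Lemma antipode_comul_u r : S2 (Delta (laurent_u K k r)) =
  tleft (laurent_u K k r) - tright (laurent_u K k r).
Proof.
rewrite t2lift_comul_u; congr (_ + _).
rewrite [LHS]/= [S _]antipode_u; exact: linN ((tpure_bilin A).2 1) _.
Qed.

Lemma laurent_galoisK a : t2lift Delta (@tright K A) (S2 (Delta a)) = tleft a.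
Proof.
apply: (laurent_hom_eq (f := t2lift Delta (@tright K A) \o (S2 \o Delta))
  (f' := @tleft K A)) => [s|s|r]; rewrite [LHS]/=.
- rewrite [S2 _]antipode_comul_t t2liftE [X in X * _]comul_t [LHS]tpureM.
  by rewrite laurent_tK mulr1.
- rewrite [S2 _]antipode_comul_tinv t2liftE [X in X * _]comul_tinv [LHS]tpureM.
  by rewrite laurent_tVK mulr1.
rewrite [S2 _]antipode_comul_u (linB (t2lift_is_linear _ _)) !t2liftE.
rewrite [X in X * _ - _]comul_u [X in _ * X - _](rmorph1 (@tright K A)) mulr1.
by rewrite [X in _ - X * _](rmorph1 Delta) mul1r addrK.
Qed.

Lemma laurent_galoisVK a :
  t2lift (S2 \o Delta) (@tright K A) (Delta a) = tleft a.
Proof.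
apply: (laurent_hom_eq (f := t2lift (S2 \o Delta) (@tright K A) \o Delta)
  (f' := @tleft K A)) => [s|s|r]; rewrite [LHS]/=.
- rewrite t2lift_comul_t [X in X * _]antipode_comul_t [LHS]tpureM.
  by rewrite laurent_tVK mulr1.
- rewrite t2lift_comul_tinv [X in X * _]antipode_comul_tinv [LHS]tpureM.
  by rewrite laurent_tK mulr1.
by rewrite t2lift_comul_u [X in X + _]antipode_comul_u subrK.
Qed.

Let J := @laurent_ideal K k l.

Lemma laurent_ideal_counit a : J a -> eps a = 0.
Proof.
case=> [s|r]; last exact: counit_u.
have epsL : linear eps by exact: (leval_is_linear counit_inv).
rewrite (linB epsL) [X in X - _]counit_t.
by rewrite [X in _ - X](rmorph1 eps) subrr.
Qed.

(** Modulo J both t_s and its inverse are 1 and u_r is 0, which are their values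
    at the identity; both sides are multiplicative in a. *)
Lemma laurent_mod_ideal a : qapi J a = (eps a : K) *: qapi J 1.
Proof.
have Jt s : qapi J (laurent_t K l s) = 1.
  apply/eqP; rewrite -subr_eq0; apply/eqP.
  rewrite -(qapi_rel (Laurent_ideal_t K l s)).
  exact: esym (linB (qapi_is_linear J) _ _).
elim/laurent_ind: a => [|s|s|r|c x y IHx IHy|x y IHx IHy].
- by rewrite [X in X *: _](rmorph1 eps) scale1r.
- by rewrite [X in X *: _]counit_t scale1r Jt.
- by rewrite [X in X *: _]counit_tinv scale1r -(laurent_tVK s) qapiM Jt mulr1.
- rewrite [X in X *: _]counit_u scale0r.
  exact: qapi_rel (Laurent_ideal_u K k r).
- rewrite (qapi_is_linear J) IHx IHy [X in _ = X *: _](linearP eps).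
  by rewrite scalerDl scalerA.
rewrite qapiM IHx IHy [X in _ = X *: _](rmorphM eps).
by rewrite -qalg_scalerAl -qalg_scalerAr scalerA mulr1.
Qed.

End LaurentHom.

Theorem proposition4p4 (R : realType) (g : finLieAlgType R[i])
    (g_simple : simple_lie g) (n : nat) (D : chevalley g n)
    (k l : nat) (i : 'I_n) :
  let A := laurent R[i] k l in
  let I := @laurent_ideal R[i] k l in
  let W := fund_weyl D A i in
  let T := twisted (@comul R[i] k l) (local_fund_weyl D i I) in
  exists f : W -> T,
    [/\ is_bimod_iso f,
        f (fund_gen D A i) = wpure (@comul R[i] k l) (local_fund_gen D i I) 1 &
        forall f' : W -> T, is_lmod_hom f' ->
          f' (fund_gen D A i) =
            wpure (@comul R[i] k l) (local_fund_gen D i I) 1 ->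
          f' =1 f].
Proof.
exact: (fund_weyl_iso D i (@laurent_counitl R[i] k l)
  (@laurent_antipoder R[i] k l) (@laurent_galoisK R[i] k l)
  (@laurent_galoisVK R[i] k l) (@laurent_ideal_counit R[i] k l)
  (@laurent_mod_ideal R[i] k l)).
Qed.
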